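(* Let $\delta\in(0,1)$ and let $m,n\in\mathbb{N}$ (so $m\ge 1$) satisfy $$m=\left\lfloor\frac{n}{48(\sqrt{2}\ln(2n)-\ln\delta)}\right\rfloor .$$ Then for every $d\in\mathbb N$, $$e^{\rm avg}(n,d;\Lambda^{\rm std})\le\Big(1+\frac{4m}{n}\Big)^{1/2}\frac{1}{\sqrt{1-\delta}}\,e^{\rm avg}(m,d;\Lambda^{\rm all}).$$
   Context: Setting (average case approximation). For each $d\in\mathbb N$: $D_d\subset\mathbb R^d$ is a Borel set of positive Lebesgue measure, $\rho_d$ is a probability density on $D_d$, and $G_d=L_2(D_d,\rho_d(x)\,dx)$. $F_d$ is a separable Banach space of real-valued functions on $D_d$, continuously embedded in $G_d$, such that every point evaluation $f\mapsto f(x)$, $x\in D_d$, is a continuous linear functional on $F_d$; $F_d$ carries a zero-mean Gaussian measure $\mu_d$. ${\rm APP}_d:F_d\to G_d$, ${\rm APP}_d f=f$. $\Lambda^{\rm all}$ is the class of all continuous linear functionals on $F_d$, $\Lambda^{\rm std}$ the class of point evaluations. For $\Lambda\in\{\Lambda^{\rm all},\Lambda^{\rm std}\}$, an algorithm is $A_{n,d}f=\phi_{n,d}(L_1(f),\dots,L_n(f))$ with $L_i\in\Lambda$ and $\phi_{n,d}:\mathbb R^n\to G_d$ measurable; its average case error is $e^{\rm avg}(A_{n,d})=\big(\int_{F_d}\|f-A_{n,d}f\|_{G_d}^2\,\mu_d(df)\big)^{1/2}$, and $e^{\rm avg}(n,d;\Lambda)$ is the infimum of $e^{\rm avg}(A_{n,d})$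 over all such algorithms using $n$ functionals from $\Lambda$ (for $n=0$, $A_{0,d}=0$). *)

(* Defs.v *)
From HB Require Import structures.
From mathcomp Require Import all_boot all_order all_algebra.
From mathcomp Require Import all_classical all_reals all_analysis.
Set Implicit Arguments.
Unset Strict Implicit.
Unset Printing Implicit Defensive.
Import Order.TTheory GRing.Theory Num.Theory.
Import numFieldNormedType.Exports.
Local Open Scope classical_set_scope.
Local Open Scope ring_scope.

Notation borel F := (g_sigma_algebraType (@open F)).

(* Lebesgue measure on R^d = d.-tuple R (with its product Borel
   sigma-algebra): the measure giving each closed box its volume.
   (Boxes form a generating pi-system covering R^d by countably many
   boxes of finite measure, so this characterizes Lebesgue measure on the
   Borel sets uniquely.) *)
Definition is_lebesgue_measure {R : realType} (d : nat)
  (lam : {measure set (d.-tuple R) -> \bar R}) : Prop :=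
  forall a b : d.-tuple R, (forall i, tnth a i <= tnth b i) ->
    lam [set x | forall i, tnth a i <= tnth x i <= tnth b i]
    = (\prod_(i < d) (tnth b i - tnth a i))%:E.

Definition is_clf {R : realType} {F : normedModType R} (L : F -> R) : Prop :=
  (forall (a : R) (f g : F), L (a *: f + g) = a * L f + L g) /\ continuous L.

Definition zero_mean_gaussian {R : realType} {F : normedModType R}
  (mu : probability (borel F) R) : Prop :=
  forall L : F -> R, is_clf L ->
    (forall A : set R, measurable A -> mu (L @^-1` A) = \d_(0:R) A)
    \/ (exists s : R, s != 0 /\
         forall A : set R, measurable A -> mu (L @^-1` A) = normal_prob 0 s A).

Definition info {R : realType} {F : Type} (n : nat) (L : 'I_n -> F -> R)
  (f : F) : n.-tuple R := [tuple L i f | i < n].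

(* Admissible maps phi : R^n -> G_d = L_2(D, rho dx), represented by
   jointly measurable functions (y, x) |-> phi y x with phi y in L_2. *)
Definition admissible_phi {R : realType} (d n : nat)
  (lam : {measure set (d.-tuple R) -> \bar R}) (D : set (d.-tuple R))
  (rho : d.-tuple R -> R) (phi : n.-tuple R -> d.-tuple R -> R) : Prop :=
  measurable_fun [set: (n.-tuple R * d.-tuple R)%type]
    (fun p => phi p.1 p.2)
  /\ forall y, (\int[lam]_(x in D) ((phi y x) ^+ 2 * rho x)%:E < +oo)%E.

Definition err_avg {R : realType} {d : nat} {F : normedModType R}
  (mu : probability (borel F) R)
  (lam : {measure set (d.-tuple R) -> \bar R}) (D : set (d.-tuple R))
  (rho : d.-tuple R -> R) (ev : F -> d.-tuple R -> R)
  (n : nat) (L : 'I_n -> F -> R) (phi : n.-tuple R -> d.-tuple R -> R)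
  : \bar R :=
  sqrte (\int[mu]_f
           \int[lam]_(x in D) ((ev f x - phi (info L f) x) ^+ 2 * rho x)%:E)%E.

Definition Lambda_all {R : realType} {F : normedModType R} : set (F -> R) :=
  [set L | is_clf L].

Definition Lambda_std {R : realType} {d : nat} {F : Type}
  (D : set (d.-tuple R)) (ev : F -> d.-tuple R -> R) : set (F -> R) :=
  [set L | exists x, D x /\ L = (fun f => ev f x)].

Definition e_avg {R : realType} {d : nat} {F : normedModType R}
  (mu : probability (borel F) R)
  (lam : {measure set (d.-tuple R) -> \bar R}) (D : set (d.-tuple R))
  (rho : d.-tuple R -> R) (ev : F -> d.-tuple R -> R)
  (n : nat) (Lam : set (F -> R)) : \bar R :=
  if n is 0 then
    err_avg mu lam D rho ev (fun i : 'I_0 => fun _ => 0) (fun _ _ => 0)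
  else
  ereal_inf [set e | exists (L : 'I_n -> F -> R)
                           (phi : n.-tuple R -> d.-tuple R -> R),
                 (forall i, Lam (L i)) /\ admissible_phi lam D rho phi /\
                 e = err_avg mu lam D rho ev L phi].

Definition avg_setting {R : realType} (d : nat) (F : completeNormedModType R)
  (lam : {measure set (d.-tuple R) -> \bar R}) (D : set (d.-tuple R))
  (rho : d.-tuple R -> R) (ev : F -> d.-tuple R -> R)
  (mu : probability (borel F) R) : Prop :=
  is_lebesgue_measure lam /\
      (measurable D /\ (0 < lam D)%E) /\
      (measurable_fun D rho /\ (forall x, D x -> 0 <= rho x) /\
       (\int[lam]_(x in D) (rho x)%:E = 1)%E) /\
      (exists S : set F, countable S /\ closure S = setT) /\
      (* F is a (vector) space of real functions on D: ev is linear and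
         injective (elements are determined by their values on D) *)
      ((forall (a : R) (f g : F) x, D x -> ev (a *: f + g) x = a * ev f x + ev g x)
       /\ (forall f g : F, (forall x, D x -> ev f x = ev g x) -> f = g)) /\
      (forall x, D x -> continuous (fun f : F => ev f x)) /\
      (* continuous embedding F -> G_d = L_2(D, rho dx) *)
      ((forall f : F, measurable_fun D (ev f)) /\
       exists C : R, forall f : F,
         (\int[lam]_(x in D) ((ev f x) ^+ 2 * rho x)%:E <= (C * `|f| ^+ 2)%:E)%E) /\
  zero_mean_gaussian mu.

(* Main.v *)
(* Let the information [L_1, ..., L_m] be arbitrary continuous linear
   functionals.  For Gaussian [f] the residual of the linear regression of
   [f(x)] on [L f] is independent of [L f], so no [phi] beats that regression,
   whose values lie in the span [V] of the covariances [x |-> E f(x) L_i f].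
   Hence [E |f - P_V f|^2 <= err(L, phi)^2], and no spectral theory is needed.

   Let [eta_1, ..., eta_k] be an orthonormal basis of [V] and [g = f - P_V f].
   With a random point [x] drawn from the density [om] proportional to
   [|eta|^2 / k + E g^2 / E |g|^2], the coefficients of [P_V f] are estimated by
   the stochastic gradient recursion
     [c := c + th * eta(x) / om(x) * (f(x) - <c, eta(x)>)].
   Its error splits into a part linear in [f] along [V], the defect of
   exactness, and the noise coming from [g]; a weighted sum [U] of their squared
   norms satisfies
     [E U' <= (1 - 2 th + 4 k th^2) U + 2 th^2 k E |g|^2],
   since [g] is orthogonal to [eta].  So the points can be chosen one after the
   other, and after [n] steps the defect has norm at most [1/10].  Inverting it
   makes the estimator exact on [V], with noise at most [(4 k / n) E |g|^2].
   This replaces the matrix concentration inequality for least squares. *)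
Require Import Defs.
From HB Require Import structures.
From mathcomp Require Import all_boot all_order all_algebra.
From mathcomp Require Import all_classical all_reals all_analysis.
From mathcomp Require Import measurable_realfun ring lra.
Import Order.TTheory GRing.Theory Num.Theory.
Import numFieldNormedType.Exports.
Local Open Scope classical_set_scope.
Local Open Scope ring_scope.
Set Implicit Arguments.
Unset Strict Implicit.
Unset Printing Implicit Defensive.

(** * Real integrals and psd forms *)

(** Nothing is random in [f] while the points are chosen: the residual at [x] is a vector of
    [L2space mu], the recursion acts on families of such vectors, and [energy] is already an average
    over [mu]. So one set of points and weights serves all [f] at once; chance enters only through
    an integral over [x] that is at most 0. Zero-mean Gaussian measures are given by the laws of
    single functionals. Independence therefore has to be recovered from one-dimensional laws
    ([cramer_wold]), and the finiteness of the mean square norm has to be proved ([efin]). The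
    constants: [48 * sqrt 2 > 67] and [- ln delta > 0] turn the choice of [m] into
    [67 m ln (2 n) <= n], which lets the recursion forget its initial defect within a quarter of the
    steps. A slack [t > 0] keeps the sampling density positive even when [g] vanishes; it tends to 0
    at the very end. *)

Section real_integrals.
Context d (T : measurableType d) (R : realType) (mu : {measure set T -> \bar R}).
Implicit Types f g : T -> R.

Definition L1 f := mu.-integrable setT (EFin \o f).

Lemma L1_measurable f : L1 f -> measurable_fun setT f.
Proof. by move=> /measurable_int/measurable_EFinP. Qed.

Lemma L1D f g : L1 f -> L1 g -> L1 (fun x => f x + g x).
Proof. by move=> f1 g1; exact: (integrableD measurableT f1 g1). Qed.

Lemma L1Z a f : L1 f -> L1 (fun x => a * f x).
Proof. by move=> f1; exact: (integrableZl measurableT a f1). Qed.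

Lemma L1_sum (I : Type) (s : seq I) (F : I -> T -> R) :
  (forall i, L1 (F i)) -> L1 (fun x => \sum_(i <- s) F i x).
Proof.
move=> F1; elim: s => [|i s IHs].
  by under eq_fun do rewrite big_nil; exact: integrable0.
by under eq_fun do rewrite big_cons; exact: L1D.
Qed.

Lemma L1_le f g : measurable_fun setT g -> (forall x, `|g x| <= f x) ->
  L1 f -> L1 g.
Proof.
move=> mg gf; apply: le_integrable => //; first exact/measurable_EFinP.
by move=> x _ /=; rewrite lee_fin (le_trans (gf x))// ler_norm.
Qed.

Lemma RintD f g : L1 f -> L1 g ->
  \int[mu]_x (f x + g x) = \int[mu]_x f x + \int[mu]_x g x.
Proof. exact: RintegralD. Qed.

Lemma RintZ a f : L1 f -> \int[mu]_x (a * f x) = a * \int[mu]_x f x.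
Proof. exact: RintegralZl. Qed.

Lemma Rint_sum (I : Type) (s : seq I) (F : I -> T -> R) :
  (forall i, L1 (F i)) ->
  \int[mu]_x (\sum_(i <- s) F i x) = \sum_(i <- s) \int[mu]_x F i x.
Proof.
move=> F1; elim: s => [|i s IHs].
  under eq_Rintegral do rewrite big_nil.
  by rewrite big_nil /Rintegral integral0.
under eq_Rintegral do rewrite big_cons.
by rewrite big_cons RintD ?IHs//; exact: L1_sum.
Qed.

Lemma EFin_Rint f : L1 f -> (\int[mu]_x f x)%:E = (\int[mu]_x (f x)%:E)%E.
Proof. by move=> f1; rewrite fineK//; exact: integrable_fin_num. Qed.

Lemma L1_ge0P f : measurable_fun setT f -> (forall x, 0 <= f x) ->
  (\int[mu]_x (f x)%:E < +oo)%E -> L1 f.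
Proof.
move=> mf f0 fy; apply/integrableP; split; first exact/measurable_EFinP.
by under eq_integral do rewrite /= ger0_norm//.
Qed.

Lemma Rint_ge0 f : (forall x, 0 <= f x) -> 0 <= \int[mu]_x f x.
Proof. by move=> f0; apply: Rintegral_ge0. Qed.

(** First-moment method. The point is sought in [D], a set of full measure, because only points of
    [D] give admissible evaluations. *)
Lemma Rint_le0_exists (D : set T) f : measurable D -> mu (~` D) = 0%E ->
  (0 < mu setT)%E -> L1 f -> \int[mu]_x f x <= 0 ->
  exists2 x, D x & f x <= 0.
Proof.
move=> mD D0 mu0 f1 fle0; apply: contrapT => nD.
have fgt0 x : D x -> 0 < f x.
  by move=> Dx; rewrite ltNge; apply/negP => fx; apply: nD; exists x.
have mf := L1_measurable f1.
have aeD : {ae mu, forall x, D x}.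
  by exists (~` D); split => //; exact: measurableC.
(* Almost everywhere [|f| = f], so the integral of [|f|] is 0 and [f] vanishes almost everywhere,
   against [f > 0] on [D]. *)
have absf : (\int[mu]_x `|(f x)%:E|)%E = 0%E.
  have -> : (\int[mu]_x `|(f x)%:E| = \int[mu]_x (f x)%:E)%E.
    apply: ae_eq_integral => //.
    - exact/measurableT_comp/measurable_EFinP.
    - exact/measurable_EFinP.
    - by apply: filterS aeD => x /fgt0 fx _; rewrite gee0_abs ?lee_fin ?ltW.
  apply/eqP; rewrite eq_le; apply/andP; split.
    by rewrite -EFin_Rint// lee_fin.
  have <- : (\int[mu]_x `|(f x)%:E| = \int[mu]_x (f x)%:E)%E.
    apply: ae_eq_integral => //.
    - exact/measurableT_comp/measurable_EFinP.
    - exact/measurable_EFinP.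
    - by apply: filterS aeD => x /fgt0 fx _; rewrite gee0_abs ?lee_fin ?ltW.
  exact: integral_ge0.
have /(ae_eq_integral_abs mu measurableT)f0 : measurable_fun setT (EFin \o f).
  exact/measurable_EFinP.
have {}f0 := (f0 .1 absf).
have : {ae mu, forall x : T, False}.
  apply: filterS2 aeD f0 => x Dx /(_ I) [fx0].
  by have := fgt0 _ Dx; rewrite fx0 ltxx.
case=> A [mA A0 subA]; move: mu0.
suff -> : [set: T] = A by rewrite A0 ltxx.
by apply/seteqP; split => // x _; apply: subA => /=; exact.
Qed.

End real_integrals.

Lemma L1_cst d (T : measurableType d) (R : realType) (P : probability T R) (c : R) :
  L1 P (fun=> c).
Proof. exact: finite_measure_integrable_cst. Qed.

Lemma Rint_cst d (T : measurableType d) (R : realType) (P : probability T R) (c : R) :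
  \int[P]_x c = c.
Proof.
rewrite /Rintegral integral_cst//=.
by rewrite [X in (_ * X)%E](_ : _ = 1%E) ?mule1//; exact: probability_setT.
Qed.

Section psd_form.
Context {R : realType} {H : lmodType R} (B : H -> H -> R).

(** Only semi-definite: the main instance is [ip] on square-integrable functions, where a function
    vanishing almost everywhere is null without being zero. *)
Definition psd_form :=
  [/\ forall a u v w, B (a *: u + v) w = a * B u w + B v w,
      forall u v, B u v = B v u
    & forall u, 0 <= B u u].

Hypothesis psdB : psd_form.

Let BC u v : B u v = B v u. Proof. by case: psdB. Qed.

Lemma form_ge0 u : 0 <= B u u. Proof. by case: psdB. Qed.

Lemma formDl u v w : B (u + v) w = B u w + B v w.
Proof. by case: psdB => lB _ _; rewrite -[u]scale1r lB mul1r scale1r. Qed.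

Lemma formZl a u w : B (a *: u) w = a * B u w.
Proof.
case: psdB => lB _ _; have B0 : B 0 w = 0.
  have := formDl 0 0 w; rewrite addr0 => /eqP.
  by rewrite -subr_eq0 opprD addrA subrr sub0r oppr_eq0 => /eqP.
by rewrite -[a *: u]addr0 lB B0 addr0.
Qed.

Lemma formBl u v w : B (u - v) w = B u w - B v w.
Proof. by rewrite formDl -scaleN1r formZl mulN1r. Qed.

Lemma form_suml (I : Type) (r : seq I) (F : I -> H) w :
  B (\sum_(i <- r) F i) w = \sum_(i <- r) B (F i) w.
Proof.
elim: r => [|i r IHr]; last by rewrite !big_cons formDl IHr.
by rewrite !big_nil -[0](scale0r 0) formZl mul0r.
Qed.

Lemma formDr u v w : B u (v + w) = B u v + B u w.
Proof. by rewrite !(BC u) formDl. Qed.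

Lemma formZr a u w : B u (a *: w) = a * B u w.
Proof. by rewrite !(BC u) formZl. Qed.

Lemma formBr u v w : B u (v - w) = B u v - B u w.
Proof. by rewrite !(BC u) formBl. Qed.

Lemma form_sumr (I : Type) (r : seq I) (F : I -> H) w :
  B w (\sum_(i <- r) F i) = \sum_(i <- r) B w (F i).
Proof. by rewrite BC form_suml; apply: eq_bigr => i _; rewrite BC. Qed.

(** The right side minus the left side is half the sum, over all pairs, of the form at
    [a i *: y j - a j *: y i]. *)
Lemma form_comb_le (I : finType) (a : I -> R) (y : I -> H) :
  B (\sum_i a i *: y i) (\sum_i a i *: y i)
  <= (\sum_i a i ^+ 2) * \sum_i B (y i) (y i).
Proof.
rewrite form_suml mulr_suml.
rewrite -(ler_pM2l (ltr0n R 2)) !mulr_sumr.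
have -> : \sum_i 2 * (a i ^+ 2 * \sum_j B (y j) (y j)) =
    \sum_i \sum_j (a i ^+ 2 * B (y j) (y j) + a j ^+ 2 * B (y i) (y i)).
  under [RHS]eq_bigr do rewrite big_split/=.
  rewrite big_split/= [X in _ = _ + X]exchange_big/= -big_split/=.
  by apply: eq_bigr => i _; rewrite -mulr_sumr; ring.
apply: ler_sum => i _; rewrite form_sumr mulr_sumr; apply: ler_sum => j _.
rewrite formZl formZr -subr_ge0.
have := form_ge0 (a i *: y j - a j *: y i).
rewrite formBl !formBr !formZl !formZr (BC (y j) (y i)).
lra.
Qed.

(* [|a - b|^2 >= (1 - p)|a|^2 - (1/p - 1)|b|^2] at [p = 1/10]. *)
Lemma form_contraction_inv (k : nat) (P : 'M[R]_k) (y : 'I_k -> H) :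
  \sum_j \sum_l P j l ^+ 2 <= 100^-1 ->
  81 / 100 * \sum_j B (y j) (y j) <=
  \sum_j B (y j - \sum_l P j l *: y l) (y j - \sum_l P j l *: y l).
Proof.
move=> Psmall; set N := \sum_j _.
have N0 : 0 <= N by apply: sumr_ge0 => j _; exact: form_ge0.
have PN : \sum_j B (\sum_l P j l *: y l) (\sum_l P j l *: y l) <= 100^-1 * N.
  apply: (@le_trans _ _ ((\sum_j \sum_l P j l ^+ 2) * N)).
    by rewrite mulr_suml; apply: ler_sum => j _; exact: form_comb_le.
  exact: ler_wpM2r.
apply: (@le_trans _ _
    (9 / 10 * N - 9 * \sum_j B (\sum_l P j l *: y l) (\sum_l P j l *: y l))).
  lra.
rewrite /N !mulr_sumr -sumrB; apply: ler_sum => j _.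
set a := y j; set b := \sum_l _.
have := form_ge0 (a - 10 *: b).
rewrite !formBl !formBr !formZl !formZr (BC b a); lra.
Qed.

End psd_form.

(** For a vector [u] killed by [1 - P], [form_contraction_inv] with the product of [R] as form gives
    [81/100 |u|^2 <= 0]. *)
Lemma frobenius_small_unit {R : realType} (k : nat) (P : 'M[R]_k) :
  \sum_j \sum_l P j l ^+ 2 <= 100^-1 -> 1%:M - P \in unitmx.
Proof.
move=> Psmall; rewrite -unitmx_tr -row_free_unit -kermx_eq0.
apply/eqP/row_matrixP => i; rewrite row0.
have /sub_kermxP : (row i (kermx (1%:M - P)^T) <= kermx (1%:M - P)^T)%MS.
  exact: row_sub.
move: (row i _) => u uP.
have psd : @psd_form R R^o (fun a b => a * b).
  split=> [a b c d|b c|b]; [by rewrite mulrDl -mulrA|exact: mulrC|].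
  by rewrite -expr2 sqr_ge0.
have := form_contraction_inv psd (fun j => u 0 j : R^o) Psmall.
have -> : \sum_j ((u 0 j : R^o) - \sum_l P j l *: (u 0 l : R^o)) *
    ((u 0 j : R^o) - \sum_l P j l *: (u 0 l : R^o)) = 0.
  apply: big1 => j _.
  have uj : u 0 j = \sum_l P j l * u 0 l.
    move/matrixP/(_ 0 j)/eqP: uP.
    rewrite linearB/= mulmxBr trmx1 mulmx1 !mxE subr_eq0 => /eqP ->.
    by apply: eq_bigr => l _; rewrite mxE mulrC.
  by rewrite [X in X - _]uj subrr mul0r.
move=> u0; apply/rowP => j; rewrite [RHS]mxE; apply/eqP.
rewrite -sqrf_eq0 eq_le sqr_ge0 andbT expr2.
have uu l : 0 <= u 0 l * u 0 l by rewrite -expr2 sqr_ge0.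
suff : \sum_l u 0 l * u 0 l <= 0.
  by apply: le_trans; rewrite (bigD1 j)//= lerDl sumr_ge0.
lra.
Qed.

(** * Stochastic approximation of the coefficients *)

Section sgd.
Context d (T : measurableType d) (R : realType) (nu : probability T R).
Context (H : lmodType R) (B : H -> H -> R) (psdB : psd_form B).
Variables (D : set T) (k : nat) (eta : 'I_k -> T -> R) (g : T -> H).
Variables (om : T -> R) (q : R).
Hypotheses (k_gt0 : (0 < k)%N) (mD : measurable D) (nuD : nu (~` D) = 0%E).
Hypotheses (om_gt0 : forall x, 0 < om x)
  (eta_om : forall x, \sum_j eta j x ^+ 2 <= 2 * k%:R * om x)
  (etag_om : forall x,
    (\sum_j eta j x ^+ 2) * B (g x) (g x) <= q * om x ^+ 2).
Hypotheses (L1om : L1 nu om) (om1 : \int[nu]_x om x = 1).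
Hypotheses (L1eta : forall i j, L1 nu (fun x => eta i x * eta j x))
  (eta_on : forall i j, \int[nu]_x (eta i x * eta j x) = (i == j)%:R).
Hypotheses (L1etag : forall j h, L1 nu (fun x => eta j x * B h (g x)))
  (eta_orth : forall j h, \int[nu]_x (eta j x * B h (g x)) = 0).

(** The recursion satisfied by the error [z] of the estimate. Dividing by [om x] makes the mean
    increment under the density [om] equal to [- th *: z]. *)
Definition sgd_upd (th : R) (x : T) (z : 'I_k -> H) : 'I_k -> H :=
  fun j => z j + (th * (eta j x / om x)) *: (g x - \sum_l eta l x *: z l).

Definition energy (z : 'I_k -> H) := \sum_j B (z j) (z j).

Lemma energy_ge0 z : 0 <= energy z.
Proof. by apply: sumr_ge0 => j _; exact: form_ge0. Qed.

(** The factor [om x] prepares the integration against [nu], which is then the expectation under the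
    density [om]: the bracket integrates to [- (2 th - 4 k th^2) * energy z]. In the term of order
    [th^2], [|g - s|^2 <= 2 |g|^2 + 2 |s|^2] separates the two parts that [etag_om] and [eta_om]
    control. *)
Lemma energy_upd_le th z x : 
  om x * energy (sgd_upd th x z) <=
  om x * (energy z + 2 * th ^+ 2 * q)
  + (2 * th * \sum_j eta j x * B (z j) (g x)
  - (2 * th - 4 * k%:R * th ^+ 2)
    * \sum_j \sum_l B (z j) (z l) * (eta j x * eta l x)).
Proof.
set s := \sum_l eta l x *: z l; set dd := g x - s.
have -> : \sum_j eta j x * B (z j) (g x) = B s (g x).
  by rewrite /s (form_suml psdB); apply: eq_bigr => j _; rewrite (formZl psdB).
have -> : \sum_j \sum_l B (z j) (z l) * (eta j x * eta l x) = B s s.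
  rewrite /s (form_suml psdB); apply: eq_bigr => j _.
  rewrite (form_sumr psdB); apply: eq_bigr => l _.
  by rewrite (formZl psdB) (formZr psdB); ring.
have om0 := om_gt0 x; have omN0 : om x != 0 by rewrite gt_eqF.
set e2 := \sum_j eta j x ^+ 2.
have -> : energy (sgd_upd th x z) =
    energy z + 2 * (th / om x) * B s dd + (th / om x) ^+ 2 * e2 * B dd dd.
  rewrite /energy /s (form_suml psdB) /e2 mulr_sumr mulr_sumr mulr_suml -!big_split/=.
  apply: eq_bigr => j _; rewrite /sgd_upd -/s -/dd; move: dd => dd.
  case: psdB => _ symB _.
  by rewrite (formDl psdB) !(formDr psdB) !(formZl psdB) !(formZr psdB) (symB dd (z j)); ring.
have dd2 : B dd dd <= 2 * B (g x) (g x) + 2 * B s s.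
  have := form_ge0 psdB (g x + s).
  rewrite /dd !(formBl psdB) !(formBr psdB) !(formDl psdB) !(formDr psdB); lra.
have sdd : B s dd = B s (g x) - B s s by rewrite /dd formBr.
have -> : om x * (energy z + 2 * (th / om x) * B s dd
      + (th / om x) ^+ 2 * e2 * B dd dd) =
    om x * energy z + 2 * th * B s dd + th ^+ 2 * (e2 / om x * B dd dd).
  by field.
have e2dd : e2 / om x * B dd dd <= 2 * q * om x + 4 * k%:R * B s s.
  have e20 : 0 <= e2 by apply: sumr_ge0 => j _; exact: sqr_ge0.
  apply: (@le_trans _ _ (e2 / om x * (2 * B (g x) (g x) + 2 * B s s))).
    by apply: ler_wpM2l => //; rewrite divr_ge0// ltW.
  have -> : e2 / om x * (2 * B (g x) (g x) + 2 * B s s) =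
      2 * (e2 * B (g x) (g x) / om x) + 2 * (e2 / om x * B s s) by field.
  have h1 : e2 * B (g x) (g x) / om x <= q * om x.
    by rewrite ler_pdivrMr// -mulrA -expr2; exact: etag_om.
  have h2 : e2 / om x * B s s <= 2 * k%:R * B s s.
    by apply: ler_wpM2r; rewrite ?(form_ge0 psdB)// ler_pdivrMr//; exact: eta_om.
  lra.
have := ler_wpM2l (sqr_ge0 th) e2dd; rewrite sdd; lra.
Qed.

Lemma sgd_step th z : exists2 x, D x &
  energy (sgd_upd th x z) <=
  (1 - 2 * th + 4 * k%:R * th ^+ 2) * energy z + 2 * th ^+ 2 * q.
Proof.
apply: contrapT => nx.
set c := _ + _ in nx.
pose f x := (2 * th * \sum_j eta j x * B (z j) (g x)
  - (2 * th - 4 * k%:R * th ^+ 2)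
    * \sum_j \sum_l B (z j) (z l) * (eta j x * eta l x)).
pose f1 x := \sum_j eta j x * B (z j) (g x).
pose f2 x := \sum_j \sum_l B (z j) (z l) * (eta j x * eta l x).
have L1f1 : L1 nu f1 by apply: L1_sum => j; exact: L1etag.
have L1f2 : L1 nu f2.
  by apply: L1_sum => j; apply: L1_sum => l; exact/L1Z/L1eta.
have if1 : \int[nu]_x f1 x = 0.
  rewrite Rint_sum; last by move=> j; exact: L1etag.
  by apply: big1 => j _; exact: eta_orth.
have if2 : \int[nu]_x f2 x = energy z.
  rewrite Rint_sum; last by move=> j; apply: L1_sum => l; exact/L1Z/L1eta.
  apply: eq_bigr => j _; rewrite Rint_sum; last by move=> l; exact/L1Z/L1eta.
  rewrite (bigD1 j)//= RintZ// eta_on eqxx mulr1 big1 ?addr0// => l lj.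
  by rewrite RintZ// eta_on eq_sym (negbTE lj) mulr0.
pose a := 2 * th - 4 * k%:R * th ^+ 2.
have [x Dx] : exists2 x, D x &
    (2 * th * f1 x + - a * f2 x) + (a * energy z) * om x <= 0.
  have nu1 : (0 < nu setT)%E by rewrite probability_setT lte01.
  apply: (Rint_le0_exists mD nuD nu1).
    by apply: L1D; [apply: L1D|]; exact: L1Z.
  rewrite RintD; [|by apply: L1D; exact: L1Z|exact: L1Z].
  rewrite RintD; [|exact: L1Z|exact: L1Z].
  rewrite !RintZ// if1 if2 om1; lra.
have om0 := om_gt0 x; have := energy_upd_le th z x.
rewrite -/(f1 x) -/(f2 x) -/a => h1 h2; apply: nx; exists x => //.
rewrite -(ler_pM2l om0); apply: (le_trans h1); rewrite /c; move: h2; rewrite /a.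
lra.
Qed.

Variables (z0 : 'I_k -> H) (G : T -> H).
Hypothesis gE : forall x, g x = G x + \sum_l eta l x *: z0 l.

(** Records that the error comes from honest weights on sampled data: [G] is the contribution of one
    sample, while [g], seen by the recursion, also contains the initial error [z0]. The weights [w]
    are what is extracted in the end. *)
Definition sampled n (z : 'I_k -> H) := exists (xs : 'I_n -> T) (w : 'I_n -> 'I_k -> R),
  (forall i, D (xs i)) /\ forall j, z j = z0 j + \sum_i w i j *: G (xs i).

Lemma sampled_upd n th x z : D x -> sampled n z ->
  sampled n.+1 (sgd_upd th x z).
Proof.
move=> Dx [xs [w [Dxs zE]]].
pose a j := th * (eta j x / om x).
(* The new point takes index 0 and weight [a j]; the feedback term of the update corrects the older
   weights. *)
exists (fun i => oapp xs x (unlift ord0 i)).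
exists (fun i j => oapp (fun i' => w i' j - a j * \sum_l eta l x * w i' l)
  (a j) (unlift ord0 i)).
split=> [i|j]; first by case: unliftP => [i0 _|_] /=.
rewrite big_ord_recl unlift_none/=.
under [X in _ = _ + (_ + X)]eq_bigr do rewrite liftK/=.
rewrite /sgd_upd gE -/(a j).
have -> : \sum_l eta l x *: z l = \sum_l eta l x *: z0 l +
    \sum_i (\sum_l eta l x * w i l) *: G (xs i).
  under [X in _ = _ + X]eq_bigr do rewrite scaler_suml.
  rewrite exchange_big/= -big_split/=; apply: eq_bigr => l _.
  rewrite zE scalerDr scaler_sumr; congr (_ + _).
  by apply: eq_bigr => i _; rewrite scalerA.
under [X in _ = _ + (_ + X)]eq_bigr do rewrite scalerBl -scalerA.
rewrite sumrB -scaler_sumr zE opprD addrA addrK scalerBr.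
by rewrite -!addrA; congr (_ + _); rewrite addrCA.
Qed.

Fixpoint rate (th : nat -> R) (u0 : R) n : R :=
  if n is n'.+1 then
    (1 - 2 * th n' + 4 * k%:R * th n' ^+ 2) * rate th u0 n' + 2 * th n' ^+ 2 * q
  else u0.

Lemma sgd_iterate (th : nat -> R) n :
  exists2 z, sampled n z & energy z <= rate th (energy z0) n.
Proof.
elim: n => [|n [z zs zle]].
  exists z0 => //; exists (fun i : 'I_0 => point), (fun=> fun=> 0); split=> [[]//|j].
  by rewrite big_ord0 addr0.
have [x Dx xle] := sgd_step (th n) z.
exists (sgd_upd (th n) x z); first exact: sampled_upd.
apply: (le_trans xle) => /=; rewrite lerD2r; apply: ler_wpM2l => //.
(* Since [k >= 1], the factor is at least [(1 - th)^2], so it is nonnegative for every step. *)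
have : 1 <= k%:R :> R by rewrite ler1n.
have := sqr_ge0 (1 - th n); have := sqr_ge0 (th n); nra.
Qed.

End sgd.

(** * Numerical solution of the energy recursion *)

Section step_sizes.
Context {R : realType} (k n : nat).
Hypothesis k_gt0 : (0 < k)%N.
Hypothesis kn : 67 * k%:R * ln (2 * n%:R) <= n%:R :> R.
Hypothesis n_gt0 : (0 < n)%N.

Let kge1 : 1 <= k%:R :> R. Proof. by rewrite ler1n. Qed.
Let nge1 : 1 <= n%:R :> R. Proof. by rewrite ler1n. Qed.

(* Constant step [1/(24 k)] for [n/4] steps, which kills the initial error,
   then steps [1/(j + 24 k)], which bring the noise down to the rate [1/n]. *)
Definition step_size (i : nat) : R := (24 * k%:R + (i - n %/ 4)%:R)^-1.

Lemma ln_ge_1subV (x : R) : 0 < x -> 1 - x^-1 <= ln x.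
Proof.
move=> x0; rewrite lerBlDr -lerBlDl.
have := expR_ge1Dx (- ln x); rewrite expRN lnK ?posrE//; lra.
Qed.

(** Bootstrapping: [ln (2 n) >= 1/2] already forces [n >= 33] through [kn], and then [ln (2 n) = 2
    ln (sqrt (2 n)) >= 2 (1 - 1/8)]. *)
Lemma ln2n_ge1 : 1 <= ln (2 * n%:R) :> R.
Proof.
have k1 := kge1; have n1 := nge1.
have n33 : 33 <= n%:R :> R.
  have n20 : 0 < 2 * n%:R :> R by lra.
  have := ln_ge_1subV n20.
  have : (2 * n%:R)^-1 <= 2^-1 :> R by rewrite lef_pV2 ?posrE; lra.
  move=> h1 h2; have := kn.
  have : 0 <= (k%:R - 1) * (ln (2 * n%:R) - 2^-1) :> R by rewrite mulr_ge0//; lra.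
  lra.
have -> : 2 * n%:R = (Num.sqrt (2 * n%:R)) ^+ 2 :> R by rewrite sqr_sqrtr; lra.
have s8 : 8 <= Num.sqrt (2 * n%:R) :> R.
  rewrite -(@ger0_norm _ 8)// -sqrtr_sqr ler_wsqrtr//; lra.
rewrite lnXn; last lra.
have s0 : 0 < Num.sqrt (2 * n%:R) :> R by lra.
have := ln_ge_1subV s0.
have : (Num.sqrt (2 * n%:R))^-1 <= 8^-1 :> R by rewrite lef_pV2 ?posrE; lra.
rewrite mulr2n; lra.
Qed.

Variable q : R.
Hypothesis q_gt0 : 0 < q.

(** At [th = 1/(24 k)] the factor is [1 - 11/(144 k)], at most the exponential, and [q / (22 k)] is
    the fixed point of the recursion. *)
Lemma rate_phase1 u0 i : 0 <= u0 -> (i <= n %/ 4)%N ->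
  rate k q step_size u0 i <=
  u0 * expR (- (11 / 144) / k%:R) ^+ i + q / (22 * k%:R).
Proof.
have k1 := kge1; have n1 := nge1; have q0 := q_gt0.
move=> u00; elim: i => [_|i IHi ilt].
  rewrite expr0 mulr1 /= lerDl divr_ge0//; lra.
have k0 : 0 < k%:R :> R by lra.
have ki : 0 < (k%:R)^-1 :> R by rewrite invr_gt0.
have kk : k%:R / k%:R = 1 :> R by rewrite divff// gt_eqF.
(* The subtraction in [step_size] is truncated, so it gives 0 throughout this phase. *)
have sz : step_size i = (24 * k%:R)^-1.
  by rewrite /step_size (eqP (ltnW ilt : (i - n %/ 4 == 0)%N)) addr0.
rewrite /= sz.
set r := rate _ _ _ _ _ in IHi *.
have -> : 1 - 2 * (24 * k%:R)^-1 + 4 * k%:R * (24 * k%:R)^-1 ^+ 2 =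
    1 - 11 / 144 / k%:R :> R by field; rewrite gt_eqF.
have -> : 2 * (24 * k%:R)^-1 ^+ 2 * q = q / k%:R / k%:R / 288 :> R.
  by field; rewrite gt_eqF.
have c0 : 0 <= 1 - 11 / 144 / k%:R :> R.
  have : (k%:R)^-1 <= 1 :> R by rewrite invf_le1.
  lra.
apply: (le_trans (lerD (ler_wpM2l c0 (IHi (ltnW ilt))) (lexx _))).
have -> : q / (22 * k%:R) = q / k%:R / 22 :> R by field; rewrite gt_eqF.
rewrite mulrDr -addrA; apply: lerD; last first.
  have -> : (1 - 11 / 144 / k%:R) * (q / k%:R / 22) + q / k%:R / k%:R / 288 =
    q / k%:R / 22 :> R by field; rewrite gt_eqF.
  exact: lexx.
rewrite mulrCA exprS; apply: ler_wpM2l => //; apply: ler_wpM2r.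
  by rewrite exprn_ge0// expR_ge0.
by have := expR_ge1Dx (- (11 / 144) / k%:R : R); rewrite mulNr.
Qed.

(** With [t = 24 k + j] and [4 k / t <= 1/6], a bound [C q / t] becomes at most
    [C q (1/t - 1/t^2) <= C q / (t + 1)] as soon as [11/6 C - 2 >= C]. The least such [C] is [12/5],
    which at [j = 0] is the entry value [q / (10 k)]. *)
Lemma rate_phase2 u0 j : 0 <= u0 ->
  rate k q step_size u0 (n %/ 4) <= q / (10 * k%:R) ->
  rate k q step_size u0 (n %/ 4 + j) <= 12 / 5 * q / (24 * k%:R + j%:R).
Proof.
have k1 := kge1; have n1 := nge1; have q0 := q_gt0.
move=> u00 start; elim: j => [|j IHj].
  rewrite addn0; apply: (le_trans start).
  have -> : 12 / 5 * q / (24 * k%:R + 0%:R) = q / (10 * k%:R) :> R.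
    by rewrite addr0; field; rewrite gt_eqF//; lra.
  exact: lexx.
have sz : step_size (n %/ 4 + j) = (24 * k%:R + j%:R)^-1.
  by rewrite /step_size addKn.
rewrite addnS /= sz.
have j0 : 0 <= j%:R :> R by [].
have -> : 24 * k%:R + j.+1%:R = 24 * k%:R + j%:R + 1 :> R.
  by rewrite -addrA natr1.
set t := 24 * k%:R + j%:R in IHj *.
have t24 : 24 * k%:R <= t by rewrite /t lerDl.
have t0 : 0 < t by lra.
have kt : 4 * k%:R * t^-1 <= 6^-1 by rewrite ler_pdivrMr//; lra.
have ti : 0 < t^-1 by rewrite invr_gt0.
have t1 : t^-1 <= 24^-1 by rewrite lef_pV2 ?posrE//; lra.
set r := rate _ _ _ _ _ in IHj *.
have c0 : 0 <= 1 - 2 * t^-1 + 4 * k%:R * t^-1 ^+ 2.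
  have : 0 <= 4 * k%:R * t^-1 ^+ 2 by rewrite mulr_ge0 ?sqr_ge0//; lra.
  lra.
apply: (le_trans (lerD (ler_wpM2l c0 IHj) (lexx _))).
apply: (@le_trans _ _ (12 / 5 * q * (t^-1 - t^-1 ^+ 2))); last first.
  apply: ler_wpM2l; first lra.
  rewrite -subr_ge0.
  have -> : (t + 1)^-1 - (t^-1 - t^-1 ^+ 2) = t^-1 ^+ 2 * (t + 1)^-1 :> R.
    by field; rewrite ?gt_eqF//; lra.
  by rewrite mulr_ge0 ?sqr_ge0// invr_ge0; lra.
have := ler_wpM2r (sqr_ge0 t^-1) kt => kt2.
have := ler_wpM2l (ltW q_gt0) kt2.
lra.
Qed.

Lemma rate_final :
  rate k q step_size (320 * q / n%:R * k%:R) n <= 16 / 5 * q / n%:R.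
Proof.
have k1 := kge1; have n1 := nge1; have q0 := q_gt0.
have L1 := ln2n_ge1; set L := ln _ in L1.
have nk : 67 * L * k%:R <= n%:R by have := kn; rewrite -/L; lra.
have k0 : 0 < k%:R :> R by lra.
have n0 : 0 < n%:R :> R by lra.
have n4 : n%:R / 4 - 1 <= (n %/ 4)%:R :> R.
  have := divn_eq n 4; have := ltn_pmod n (isT : (0 < 4)%N).
  move=> /ltnW; rewrite -(ler_nat R) => h /(congr1 (fun i => i%:R : R)).
  have : (n %% 4)%:R <= 4 :> R by [].
  rewrite natrD natrM; lra.
have n4' : (n %/ 4)%:R <= n%:R / 4 :> R.
  have := leq_trunc_div n 4; rewrite -(ler_nat R) natrM; lra.
have u00 : 0 <= 320 * q / n%:R * k%:R :> R.
  by rewrite mulr_ge0// divr_ge0//; lra.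
have nE : (n = n %/ 4 + (n - n %/ 4))%N by rewrite subnKC// leq_div.
rewrite [X in rate _ _ _ _ X]nE.
apply: (le_trans (rate_phase2 _ u00 _)); last first.
  rewrite natrB ?leq_div//.
  have -> : 12 / 5 * q / (24 * k%:R + (n%:R - (n %/ 4)%:R)) =
    12 / 5 * q * (24 * k%:R + (n%:R - (n %/ 4)%:R))^-1 by [].
  have -> : 16 / 5 * q / n%:R = 12 / 5 * q * (3 / 4 * n%:R)^-1 :> R.
    by field; rewrite gt_eqF.
  apply: ler_wpM2l; first lra.
  by rewrite lef_pV2 ?posrE; lra.
apply: (le_trans (rate_phase1 u00 (leqnn _))).
(* A quarter of [67 L k] steps at rate [11 / (144 k)] gives an exponent of about [1.28 L]; rounding
   [n / 4] down costs less than [0.08], and [L >= 1]. *)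
have decay : expR (- (11 / 144) / k%:R) ^+ (n %/ 4) <= (2 * n%:R)^-1 :> R.
  rewrite -expRM_natr.
  have -> : (2 * n%:R)^-1 = expR (- L) :> R by rewrite expRN lnK// posrE; lra.
  rewrite ler_expR mulrAC mulNr mulNr lerN2 ler_pdivlMr//.
  have : L * k%:R >= k%:R by rewrite ler_peMl// ltW.
  nra.
have nnk : 4489 * k%:R ^+ 2 <= n%:R ^+ 2 :> R.
  have : 67 * k%:R <= n%:R :> R by nra.
  nra.
apply: (@le_trans _ _ (320 * q / n%:R * k%:R * (2 * n%:R)^-1 + q / (22 * k%:R))).
  by rewrite lerD2r; apply: ler_wpM2l.
rewrite -subr_ge0.
have -> : q / (10 * k%:R) - (320 * q / n%:R * k%:R * (2 * n%:R)^-1 + q / (22 * k%:R)) =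
   q / k%:R * (n%:R ^+ 2)^-1 * (12 / 220 * n%:R ^+ 2 - 160 * k%:R ^+ 2) :> R.
  by field; rewrite !gt_eqF.
have nn0 := sqr_ge0 (n%:R : R).
rewrite mulr_ge0//; last lra.
by rewrite mulr_ge0 ?divr_ge0 ?invr_ge0 ?exprn_ge0//; lra.
Qed.

End step_sizes.

(** * Sampling weights that are exact on a span and have small noise *)

Section sampling.
Context d (T : measurableType d) (R : realType) (nu : probability T R).
Context (H : lmodType R) (B : H -> H -> R) (psdB : psd_form B).
Variables (D : set T) (k n : nat) (eta : 'I_k -> T -> R) (g : T -> H).
Variables (om : T -> R) (q : R).
Hypotheses (k_gt0 : (0 < k)%N) (mD : measurable D) (nuD : nu (~` D) = 0%E).
Hypotheses (om_gt0 : forall x, 0 < om x)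
  (eta_om : forall x, \sum_j eta j x ^+ 2 <= 2 * k%:R * om x)
  (etag_om : forall x,
    (\sum_j eta j x ^+ 2) * B (g x) (g x) <= q * om x ^+ 2).
Hypotheses (L1om : L1 nu om) (om1 : \int[nu]_x om x = 1).
Hypotheses (L1eta : forall i j, L1 nu (fun x => eta i x * eta j x))
  (eta_on : forall i j, \int[nu]_x (eta i x * eta j x) = (i == j)%:R).
Hypotheses (L1etag : forall j h, L1 nu (fun x => eta j x * B h (g x)))
  (eta_orth : forall j h, \int[nu]_x (eta j x * B h (g x)) = 0).
Hypotheses (n_gt0 : (0 < n)%N) (q_gt0 : 0 < q).
Hypothesis kn : 67 * k%:R * ln (2 * n%:R) <= n%:R :> R.

(* The second component carries the defect of exactness
   [1 - \sum_i w_i eta(x_i)^T] as part of the energy, so that one and the same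
   descent controls the noise and makes the defect invertible. *)
Let K : R := 320 * q / n%:R.
Let B' (u v : H * 'rV[R]_k) : R := B u.1 v.1 + K * \sum_l u.2 0 l * v.2 0 l.

Let K_gt0 : 0 < K.
Proof. by rewrite divr_gt0 ?mulr_gt0// ltr0n. Qed.

Let psdB' : psd_form B'.
Proof.
split=> [a u v w|u v|u]; rewrite /B' /=.
- rewrite (formDl psdB) (formZl psdB) mulrDr addrACA; congr (_ + _).
  rewrite [RHS]addrC mulrCA -mulrDr; congr (_ * _).
  rewrite addrC mulr_sumr -big_split/=.
  by apply: eq_bigr => l _; rewrite !mxE; ring.
- case: psdB => _ -> _; congr (_ + _ * _).
  by apply: eq_bigr => l _; rewrite mulrC.
- rewrite addr_ge0 ?(form_ge0 psdB)//; apply: mulr_ge0; first exact: ltW.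
  by apply: sumr_ge0 => l _; rewrite -expr2 sqr_ge0.
Qed.

(** In [z j] the first component is the noise and the second the [j]-th row of the defect [P]. The
    energy starts at [K k] and ends below [16/5 q / n]. This bounds the noise directly and, as
    [K = 320 q / n], gives squared Frobenius norm of [P] at most [1/100]. *)
Lemma sampling_weights : exists (xs : 'I_n -> T) (w : 'I_n -> 'I_k -> R),
  [/\ forall i, D (xs i),
      forall j l, \sum_i w i j * eta l (xs i) = (j == l)%:R
    & energy B (fun j => \sum_i w i j *: g (xs i)) <= 4 * q / n%:R].
Proof.
have n0 : 0 < n%:R :> R by rewrite ltr0n.
pose g' x : H * 'rV[R]_k := (g x, 0).
pose z0 j : H * 'rV[R]_k := (0, delta_mx 0 j).
pose G x : H * 'rV[R]_k := (g x, - \row_l eta l x).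
have B'g u x : B' u (g' x) = B u.1 (g x).
  rewrite /B' /= big1 ?mulr0 ?addr0// => l _; by rewrite mxE mulr0.
have gE x : g' x = G x + \sum_l eta l x *: z0 l.
  have z0E : \sum_l eta l x *: z0 l = (0, \row_l eta l x) :> H * 'rV[R]_k.
    rewrite (surjective_pairing (\sum_l _)); congr (_, _).
      by rewrite raddf_sum/= big1// => l _; rewrite scaler0.
    rewrite raddf_sum/= [RHS]row_sum_delta; apply: eq_bigr => l _.
    by rewrite mxE.
  by rewrite z0E /G /g'; congr (_, _); rewrite /= ?addr0 ?addNr.
have [|||z [xs [w [Dxs zE]]] zle] := @sgd_iterate _ T R nu _ B' psdB' D k eta g' om q
  k_gt0 mD nuD om_gt0 eta_om _ L1om om1 L1eta eta_on _ _ z0 G gE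
  (step_size k n) n.
- by move=> x; rewrite B'g; exact: etag_om.
- by move=> j h; under eq_fun do rewrite B'g; exact: L1etag.
- by move=> j h; under eq_Rintegral do rewrite B'g; exact: eta_orth.
have z0k : energy B' z0 = K * k%:R.
  have -> : K * k%:R = \sum_(j < k) K by rewrite sumr_const card_ord mulr_natr.
  apply: eq_bigr => j _; rewrite /B' /=.
  rewrite -[X in B X _](scale0r 0) (formZl psdB) mul0r add0r.
  rewrite -[RHS]mulr1; congr (_ * _); rewrite (bigD1 j)//= !mxE !eqxx mulr1 big1 ?addr0// => l lj.
  by rewrite !mxE eqxx (negbTE lj) mul0r.
move: zle; rewrite z0k => /le_trans/(_ (rate_final k_gt0 kn n_gt0 q_gt0)) zle.
pose P : 'M[R]_k := \matrix_(j, l) (z j).2 0 l.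
pose z1 j := (z j).1.
have eE : energy B' z = energy B z1 + K * \sum_j \sum_l P j l ^+ 2.
  rewrite /energy /B' big_split/= mulr_sumr; congr (_ + _).
  by apply: eq_bigr => j _; congr (_ * _); apply: eq_bigr => l _; rewrite mxE expr2.
have Psmall : \sum_j \sum_l P j l ^+ 2 <= 100^-1.
  rewrite -(ler_pM2l K_gt0).
  have : 0 <= energy B z1 := energy_ge0 psdB z1.
  have -> : K * 100^-1 = 16 / 5 * q / n%:R by rewrite /K; field; rewrite gt_eqF.
  lra.
have z1le : energy B z1 <= 16 / 5 * q / n%:R.
  have : 0 <= K * \sum_j \sum_l P j l ^+ 2.
    apply: mulr_ge0; first exact: ltW.
    by apply: sumr_ge0 => j _; apply: sumr_ge0 => l _; exact: sqr_ge0.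
  lra.
have uP := frobenius_small_unit Psmall.
pose Q := invmx (1%:M - P).
have z1E j : z1 j = \sum_i w i j *: g (xs i).
  by rewrite /z1 zE/= add0r raddf_sum.
have PE j l : (1%:M - P) j l = \sum_i w i j * eta l (xs i).
  rewrite !mxE zE/= !mxE eqxx/= raddf_sum/= summxE opprD addrA eq_sym subrr add0r.
  by rewrite -sumrN; apply: eq_bigr => i _; rewrite !mxE mulrN opprK.
(* The weights [w] reproduce the span up to the matrix [1 - P], so multiplying them by its inverse
   makes them exact. The noise [y] then solves [(1 - P) y = z1], hence [81/100 |y|^2 <= |z1|^2], and
   [16/5 * 100/81 < 4]. *)
pose w' i j := \sum_m Q j m * w i m.
exists xs, w'; split => // [j l|].
  have /matrixP/(_ j l) := mulVmx uP; rewrite !mxE => <-.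
  under eq_bigr do rewrite mulr_suml.
  rewrite exchange_big/=; apply: eq_bigr => m _.
  by rewrite PE mulr_sumr; apply: eq_bigr => i _; rewrite mulrA.
set y := fun j => _.
have yE j : y j = \sum_m Q j m *: z1 m.
  rewrite /y; under eq_bigr do rewrite scaler_suml.
  rewrite exchange_big/=; apply: eq_bigr => m _.
  by rewrite z1E scaler_sumr; apply: eq_bigr => i _; rewrite scalerA.
have yP j : y j - \sum_l P j l *: y l = z1 j.
  have -> : y j - \sum_l P j l *: y l = \sum_l (1%:M - P) j l *: y l.
    have IP l : (1%:M - P) j l = (j == l)%:R - P j l by rewrite !mxE.
    under [RHS]eq_bigr do rewrite IP scalerBl.
    rewrite sumrB; congr (_ - _).
    rewrite (bigD1 j)//= eqxx scale1r big1 ?addr0// => l lj.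
    by rewrite eq_sym (negbTE lj) scale0r.
  under eq_bigr do rewrite yE scaler_sumr.
  rewrite exchange_big/=.
  have QI m : \sum_l (1%:M - P) j l * Q l m = (j == m)%:R.
    by have /matrixP/(_ j m) := mulmxV uP; rewrite mxE => ->; rewrite mxE.
  transitivity (\sum_m (j == m)%:R *: z1 m).
    apply: eq_bigr => m _; rewrite -QI scaler_suml.
    by apply: eq_bigr => l _; rewrite scalerA.
  rewrite (bigD1 j)//= eqxx scale1r big1 ?addr0// => m mj.
  by rewrite eq_sym (negbTE mj) scale0r.
have := form_contraction_inv psdB y Psmall.
under [X in _ <= X -> _]eq_bigr do rewrite yP.
rewrite -/(energy B z1) -/(energy B y) => h.
have -> : 4 * q / n%:R = 4 * (q / n%:R) by rewrite mulrA.
have h2 : energy B z1 <= 16 / 5 * (q / n%:R) by rewrite mulrA.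
have : 0 <= q / n%:R by rewrite divr_ge0 ?ltW.
lra.
Qed.

End sampling.

(** * The space L2, projections and normal equations *)

Section square_integrable.
Context d (T : measurableType d) (R : realType) (mu : {measure set T -> \bar R}).

Definition L2 (f : T -> R) :=
  measurable_fun setT f /\ L1 mu (fun x => f x ^+ 2).

Definition sqint : {pred T -> R} := [pred f | `[< L2 f >]].

Lemma sqintP f : reflect (L2 f) (f \in sqint).
Proof. exact: asboolP. Qed.

Lemma L2M f g : L2 f -> L2 g -> L1 mu (fun x => f x * g x).
Proof.
move=> [mf f2] [mg g2]; apply: (L1_le _ _ (L1D f2 g2)).
  exact: measurable_funM.
move=> x /=; rewrite normrM -[f x ^+ 2]real_normK ?num_real//.
rewrite -[g x ^+ 2]real_normK ?num_real//.
have := sqr_ge0 (`|f x| - `|g x|); have := sqr_ge0 `|f x|.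
have := sqr_ge0 `|g x|; nra.
Qed.

Lemma sqint_submod : submod_closed sqint.
Proof.
split=> [|a f g /sqintP f2 /sqintP g2]; apply/sqintP.
  split; first exact: measurable_cst.
  under eq_fun do rewrite expr0n; exact: integrable0.
have [mf ff] := f2; have [mg gg] := g2.
split; first by apply: measurable_funD => //; exact: measurable_funM.
have -> : (fun x => (a *: f + g) x ^+ 2) =
    (fun x => a ^+ 2 * f x ^+ 2 + (2 * a * (f x * g x) + g x ^+ 2)).
  by apply/funext => x; rewrite !fctE /= /GRing.scale/=; ring.
by apply: L1D; [exact: L1Z|apply: L1D => //; apply: L1Z; exact: L2M].
Qed.

HB.instance Definition _ :=
  GRing.isSubmodClosed.Build R (T -> R) sqint sqint_submod.

(** Functions rather than classes modulo null sets, so that an element can be evaluated at a sample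
    point. The price is that [ip] is only semi-definite. *)
Record L2space := MkL2space { l2fun :> T -> R; l2funP : l2fun \in sqint }.

HB.instance Definition _ := [isSub for l2fun].
HB.instance Definition _ := [Choice of L2space by <:].
HB.instance Definition _ := [SubChoice_isSubLmodule of L2space by <:].

Definition toL2 f (f2 : L2 f) : L2space := MkL2space (introT (sqintP f) f2).

Lemma L2space_L2 (u : L2space) : L2 u.
Proof. exact/sqintP/l2funP. Qed.

Lemma l2funD (u v : L2space) x : (u + v) x = u x + v x. Proof. by []. Qed.

Lemma l2funZ a (u : L2space) x : (a *: u) x = a * u x. Proof. by []. Qed.

Lemma l2funB (u v : L2space) x : (u - v) x = u x - v x. Proof. by []. Qed.

Definition ip (u v : L2space) : R := \int[mu]_x (u x * v x).

Lemma L1_ip (u v : L2space) : L1 mu (fun x => u x * v x).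
Proof. by apply: L2M; exact: L2space_L2. Qed.

Lemma ip_psd : psd_form ip.
Proof.
split=> [a u v w|u v|u].
- rewrite /ip -RintZ; last exact: L1_ip.
  rewrite -RintD; [|by apply: L1Z; exact: L1_ip|exact: L1_ip].
  by apply: eq_Rintegral => x _; rewrite l2funD l2funZ; ring.
- by apply: eq_Rintegral => x _; rewrite mulrC.
- by apply: Rint_ge0 => x; rewrite -expr2 sqr_ge0.
Qed.

Lemma EFin_ip (u : L2space) : (ip u u)%:E = (\int[mu]_x (u x ^+ 2)%:E)%E.
Proof. by rewrite /ip EFin_Rint//; exact: L1_ip. Qed.

Lemma l2fun_sum (I : Type) (s : seq I) (F : I -> L2space) x :
  (\sum_(i <- s) F i) x = \sum_(i <- s) F i x.
Proof. by elim/big_rec2: _ => // i y u _ <-. Qed.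

End square_integrable.

(** * Projections and Gram-Schmidt for a degenerate inner product *)

Section psd_form_geometry.
Context {R : realType} {H : lmodType R} (B : H -> H -> R).
Hypothesis psdB : psd_form B.

Let BC u v : B u v = B v u. Proof. by case: psdB. Qed.

Lemma form_null u v : B u u = 0 -> B u v = 0.
Proof.
move=> u0; apply/eqP; apply: contraT => b0.
(* As [B u u = 0], the form is affine along the direction [u]; this multiple of [u] brings it down
   to [- B v v - 2]. *)
have := form_ge0 psdB (v - ((B v v + 1) / B u v) *: u).
rewrite !(formBl psdB, formBr psdB) !(formZl psdB, formZr psdB) u0 (BC v u).
rewrite divfK// !mulr0 subr0; have := form_ge0 psdB v; lra.
Qed.

Lemma form_cauchy_schwarz u v : B u v ^+ 2 <= B u u * B v v.
Proof.
have [v0|v0] := eqVneq (B v v) 0.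
  by rewrite v0 mulr0 BC (form_null u v0) expr0n.
have vgt0 : 0 < B v v by rewrite lt0r v0 (form_ge0 psdB).
have := form_ge0 psdB (u - (B u v / B v v) *: v).
rewrite (formBl psdB) !(formBr psdB) !(formZl psdB) !(formZr psdB) (BC v u).
have -> : B u u - B u v / B v v * B u v -
   (B u v / B v v * B u v - B u v / B v v * (B u v / B v v * B v v)) =
   (B u u * B v v - B u v ^+ 2) / B v v by field.
by rewrite pmulr_lge0 ?invr_gt0// subr_ge0.
Qed.

Definition orthonormal k (e : 'I_k -> H) := forall i j, B (e i) (e j) = (i == j)%:R.

Definition proj_residual k (e : 'I_k -> H) u := u - \sum_j B u (e j) *: e j.

Lemma proj_residual_orth k (e : 'I_k -> H) u j : orthonormal e ->
  B (proj_residual e u) (e j) = 0.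
Proof.
move=> eo; rewrite (formBl psdB) (form_suml psdB) (bigD1 j)//=.
rewrite (formZl psdB) eo eqxx mulr1 big1 ?addr0 ?subrr// => l lj.
by rewrite (formZl psdB) eo (negbTE lj) mulr0.
Qed.

Lemma form_pythagoras k (e : 'I_k -> H) u (c : 'I_k -> R) : orthonormal e ->
  (forall j, B u (e j) = 0) ->
  B (u + \sum_j c j *: e j) (u + \sum_j c j *: e j) = B u u + \sum_j c j ^+ 2.
Proof.
move=> eo ue; set v := \sum_j _.
have uv : B u v = 0.
  by rewrite (form_sumr psdB) big1// => j _; rewrite (formZr psdB) ue mulr0.
have vv : B v v = \sum_j c j ^+ 2.
  rewrite (form_suml psdB); apply: eq_bigr => j _.
  rewrite (formZl psdB) (form_sumr psdB) (bigD1 j)//= (formZr psdB) eo eqxx.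
  rewrite mulr1 big1 ?addr0 ?expr2// => l lj.
  by rewrite (formZr psdB) eo eq_sym (negbTE lj) mulr0.
by rewrite !(formDl psdB) !(formDr psdB) (BC v u) uv vv; ring.
Qed.

(** Because of null vectors, the [h i] need not lie in the span of [e]; a residual of seminorm 0 is
    the right substitute. A vector whose residual is null adds nothing to [e], hence [k <= m]. *)
Lemma gram_schmidt m (h : 'I_m -> H) : exists k (e : 'I_k -> H),
  [/\ (k <= m)%N, orthonormal e
    & forall i, B (proj_residual e (h i)) (proj_residual e (h i)) = 0].
Proof.
elim: m h => [|m IHm] h.
  exists 0%N, (fun=> 0); split=> // [[]|[]]//.
have [k [e [km eo he]]] := IHm (fun i => h (lift ord0 i)).
set r := proj_residual e (h ord0).
have re j : B r (e j) = 0 by exact: proj_residual_orth.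
have [r0|r0] := eqVneq (B r r) 0.
  exists k, e; split => // [|i]; first exact: leqW.
  by case: (unliftP ord0 i) => [j|] ->.
have rgt0 : 0 < B r r by rewrite lt0r r0 (form_ge0 psdB).
pose r1 := (Num.sqrt (B r r))^-1 *: r.
have r1e j : B r1 (e j) = 0 by rewrite (formZl psdB) re mulr0.
have r11 : B r1 r1 = 1.
  rewrite (formZl psdB) (formZr psdB) mulrA -expr2 exprVn sqr_sqrtr ?ltW//.
  by rewrite mulVf.
pose e' := fun i : 'I_k.+1 => oapp e r1 (unlift ord0 i).
have e'o : orthonormal e'.
  move=> i j; rewrite /e'; case: (unliftP ord0 i) => [i'|] ->.
    case: (unliftP ord0 j) => [j'|] -> /=; first by rewrite eo (inj_eq lift_inj).
    by rewrite BC r1e.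
  case: (unliftP ord0 j) => [j'|] -> /=; first by rewrite r1e.
  by rewrite r11.
have e'E u : proj_residual e' u = proj_residual e u - B u r1 *: r1.
  rewrite /proj_residual big_ord_recl /e' unlift_none/=.
  under eq_bigr do rewrite liftK/=.
  by rewrite opprD addrA addrAC.
exists k.+1, e'; split => // i; rewrite e'E.
case: (unliftP ord0 i) => [j|] ->.
  have r1_0 : B (h (lift ord0 j)) r1 = 0.
    have -> : h (lift ord0 j) = proj_residual e (h (lift ord0 j)) +
        \sum_l B (h (lift ord0 j)) (e l) *: e l by rewrite subrK.
    rewrite (formDl psdB) (form_null _ (he j)) add0r (form_suml psdB) big1// => l _.
    by rewrite (formZl psdB) (BC (e l) r1) r1e mulr0.
  by rewrite r1_0 scale0r subr0.
have hr : B (h ord0) r1 = B r r1.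
  rewrite /r /proj_residual (formBl psdB) (form_suml psdB) big1 ?subr0// => l _.
  by rewrite (formZl psdB) (BC (e l) r1) r1e mulr0.
have rr1 : B r r1 = Num.sqrt (B r r).
  rewrite (formZr psdB) -{2}[B r r]sqr_sqrtr ?ltW// expr2 mulrA mulVf ?mul1r//.
  by rewrite gt_eqF// sqrtr_gt0.
rewrite -/r hr rr1 /r1 scalerA mulfV ?scale1r ?subrr; last first.
  by rewrite gt_eqF// sqrtr_gt0.
by rewrite -(scale0r 0) (formZl psdB) mul0r.
Qed.

(** Up to the null vector [z], the combination of the [h i] lies in the span of [e], so Pythagoras
    applies to [r] plus an element of that span. *)
Lemma proj_residual_le m k (h : 'I_m -> H) (e : 'I_k -> H) u (c : 'I_m -> R) :
  orthonormal e ->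
  (forall i, B (proj_residual e (h i)) (proj_residual e (h i)) = 0) ->
  B (proj_residual e u) (proj_residual e u) <=
  B (u - \sum_i c i *: h i) (u - \sum_i c i *: h i).
Proof.
move=> eo he; set r := proj_residual e u.
pose z := \sum_i c i *: proj_residual e (h i).
have z0 w : B z w = 0.
  rewrite (form_suml psdB) big1// => i _.
  by rewrite (formZl psdB) (form_null _ (he i)) mulr0.
pose b j := B u (e j) - \sum_i c i * B (h i) (e j).
have uE : u - \sum_i c i *: h i = r + \sum_j b j *: e j - z.
  have hE : \sum_i c i *: h i =
      z + \sum_j (\sum_i c i * B (h i) (e j)) *: e j.
    under [X in _ = _ + X]eq_bigr do rewrite scaler_suml.
    rewrite exchange_big/= -big_split/=; apply: eq_bigr => i _.
    under eq_bigr do rewrite -scalerA.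
    by rewrite -scaler_sumr -scalerDr subrK.
  under [X in r + X - z]eq_bigr do rewrite /b scalerBl.
  by rewrite sumrB hE /r /proj_residual opprD [- z - _]addrC !addrA subrK.
rewrite uE; set A := r + _.
rewrite (formBl psdB A z) z0 subr0 (formBr psdB A A z) (BC A z) z0 subr0 /A.
rewrite form_pythagoras//; last by move=> j; exact: proj_residual_orth.
by rewrite lerDl sumr_ge0// => j _; exact: sqr_ge0.
Qed.

(* The normal equations [c G = h] are solvable even for a singular Gram matrix
   [G], because [h] annihilates the kernel of [G]. *)
Lemma normal_equations m (L : 'I_m -> H) u (i : 'I_m) :
  let G := \matrix_(a, b) B (L a) (L b) in
  let c := \row_a B u (L a) *m pinvmx G in
  B (u - \sum_a c 0 a *: L a) (L i) = 0.
Proof.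
move=> G c; set h := \row_a B u (L a) in c *.
have hG : (h <= G)%MS.
  rewrite submxE; move: (cokermx G) (mulmx_coker G) => K GK.
  apply/eqP/rowP => j; pose v := \sum_b K b j *: L b.
  have Lv a : B (L a) v = 0.
    transitivity ((G *m K) a j); last by rewrite GK mxE.
    rewrite mxE (form_sumr psdB); apply: eq_bigr => b _.
    by rewrite (formZr psdB) mxE mulrC.
  have v0 : B v v = 0.
    by rewrite {1}/v (form_suml psdB) big1// => a _; rewrite (formZl psdB) Lv mulr0.
  transitivity (B v u); last by rewrite (form_null u v0) mxE.
  rewrite BC mxE (form_sumr psdB).
  by apply: eq_bigr => a _; rewrite (formZr psdB) mxE mulrC.
have := mulmxKpV hG => /rowP/(_ i); rewrite -/c [RHS]mxE => cG.
rewrite (formBl psdB) (form_suml psdB) -cG mxE; apply/eqP; rewrite subr_eq0; apply/eqP.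
by apply: eq_bigr => a _; rewrite (formZl psdB) [G a i]mxE.
Qed.

End psd_form_geometry.

(** * Sampling from an L2 process *)

Section real_fubini.
Context d1 d2 (O : measurableType d1) (T : measurableType d2) (R : realType).

Lemma L1_fubini (mu : probability O R) (nu : probability T R) (F : O -> T -> R) :
  L1 (mu \x nu)%E (fun p => F p.1 p.2) -> (forall f, L1 nu (F f)) ->
  L1 mu (fun f => \int[nu]_x F f x).
Proof.
move=> FL F1; have := integrable_fubini_F FL.
rewrite (_ : fubini_F _ _ = EFin \o (fun f => \int[nu]_x F f x))//.
by apply/funext => f; rewrite /= EFin_Rint.
Qed.

Lemma L1_prod_swap (mu : probability O R) (nu : probability T R) (F : O -> T -> R) :
  L1 (mu \x nu)%E (fun p => F p.1 p.2) -> L1 (nu \x mu)%E (fun p => F p.2 p.1).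
Proof.
move=> FL; have mF := measurable_int _ FL.
apply/integrable12ltyP; last exact/(integrable21ltyP _ _ mF).
rewrite (_ : EFin \o _ = (EFin \o (fun p => F p.1 p.2)) \o
  (fun p : T * O => (p.2, p.1)))//.
apply: measurableT_comp => //.
by apply/measurable_fun_pairP; split; [exact: measurable_snd|exact: measurable_fst].
Qed.

Lemma Rint_fubini (mu : probability O R) (nu : probability T R) (F : O -> T -> R) :
  L1 (mu \x nu)%E (fun p => F p.1 p.2) ->
  (forall f, L1 nu (F f)) -> (forall x, L1 mu (F^~ x)) ->
  \int[mu]_f \int[nu]_x F f x = \int[nu]_x \int[mu]_f F f x.
Proof.
move=> FL F1 F2; congr fine; have := Fubini FL => /= E.
under eq_integral do rewrite EFin_Rint//.
by under [RHS]eq_integral do rewrite EFin_Rint//.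
Qed.

Lemma L2_tensor (mu : probability O R) (nu : probability T R) (u : O -> R) (v : T -> R) :
  L2 mu u -> L2 nu v -> L2 (mu \x nu)%E (fun p => u p.1 * v p.2).
Proof.
move=> [mu_ u2] [mv v2]; have muv : measurable_fun setT (fun p : O * T => u p.1 * v p.2).
  by apply: measurable_funM; apply: measurableT_comp.
split=> //; apply/integrable12ltyP.
  by apply/measurable_EFinP; exact: measurable_funX.
rewrite (_ : (\int[mu]_x _ = (\int[mu]_f (u f ^+ 2 * \int[nu]_x (v x ^+ 2))%:E))%E).
  rewrite -EFin_Rint ?ltry//.
  by under eq_fun do rewrite mulrC; exact: L1Z.
apply: eq_integral => f _; rewrite -RintZ// EFin_Rint; last exact: L1Z.
by apply: eq_integral => x _; rewrite /= ger0_norm ?sqr_ge0// exprMn.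
Qed.

Lemma L2_prod (mu : probability O R) (nu : probability T R) (e : O -> T -> R) :
  measurable_fun setT (fun p : O * T => e p.1 p.2) ->
  (\int[mu]_f \int[nu]_x (e f x ^+ 2)%:E < +oo)%E ->
  L2 (mu \x nu)%E (fun p => e p.1 p.2).
Proof.
move=> me efin; split=> //; apply/integrable12ltyP.
  by apply/measurable_EFinP; exact: measurable_funX.
apply: le_lt_trans efin; rewrite le_eqVlt; apply/orP; left; apply/eqP.
apply: eq_integral => f _; apply: eq_integral => x _.
by rewrite /= ger0_norm ?sqr_ge0.
Qed.

End real_fubini.

Section approximation.
Context d1 d2 (O : measurableType d1) (T : measurableType d2) (R : realType).
Variables (mu : probability O R) (nu : probability T R) (e : O -> T -> R) (D : set T).
Hypotheses (mD : measurable D) (nuD : nu (~` D) = 0%E).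
Hypotheses (me : measurable_fun setT (fun p : O * T => e p.1 p.2))
  (eT : forall f, L2 nu (e f)) (eO : forall x, L2 mu (e^~ x))
  (efin : (\int[mu]_f \int[nu]_x (e f x ^+ 2)%:E < +oo)%E).

Let e2 : L2 (mu \x nu)%E (fun p => e p.1 p.2).
Proof. exact: L2_prod. Qed.

Section projection.
Variables (k : nat) (eta : 'I_k -> L2space nu).
Hypothesis eo : orthonormal (@ip _ _ _ nu) eta.

Let E f : L2space nu := toL2 (eT f).
Let X j f := ip (E f) (eta j).
Let gfun f x := e f x - \sum_j X j f * eta j x.

(** Measurability comes from Fubini; by Cauchy-Schwarz with the unit vector [eta j], the square is
    bounded by the squared norm of [E f], integrable by [e2]. *)
Let X2 j : L2 mu (X j).
Proof.
have Lex : L1 (mu \x nu)%E (fun p => e p.1 p.2 * eta j p.2).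
  apply: L2M => //.
  have := @L2_tensor _ _ _ _ _ mu nu (cst 1) (eta j).
  under eq_fun do rewrite mul1r; apply; last exact: L2space_L2.
  split; first exact: measurable_cst.
  exact: (L1_cst mu (1 ^+ 2)).
have L1X : L1 mu (X j).
  by apply: L1_fubini Lex _ => f; apply: L2M => //; exact: L2space_L2.
have mX := L1_measurable L1X.
split => //; have := L1_fubini e2.2 (fun f => (eT f).2).
apply: L1_le; first exact: measurable_funX.
move=> f; rewrite ger0_norm ?sqr_ge0//.
have := form_cauchy_schwarz (@ip_psd _ _ _ nu) (E f) (eta j).
by rewrite [X in _ * X]eo eqxx mulr1.
Qed.

Let G f : L2space nu := proj_residual (@ip _ _ _ nu) eta (E f).

Let GE f x : G f x = gfun f x.
Proof. by rewrite /G /proj_residual l2funB l2fun_sum. Qed.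

Let gx2 x : L2 mu (gfun^~ x).
Proof.
apply/sqintP; rewrite (_ : gfun^~ x = e^~ x - \sum_j eta j x *: X j).
  apply: rpredB; first exact/sqintP.
  by apply: rpred_sum => j _; apply: rpredZ; exact/sqintP.
apply/funext => f; rewrite fctE /= fct_sumE; congr (_ - _).
by apply: eq_bigr => j _; rewrite mulrC.
Qed.

Let gT2 f : L2 nu (gfun f).
Proof. by rewrite (_ : gfun f = G f) ?funeqE//; exact: L2space_L2. Qed.

Let g2 : L2 (mu \x nu)%E (fun p => gfun p.1 p.2).
Proof.
apply/sqintP; rewrite (_ : (fun p => _) =
    (fun p => e p.1 p.2) - \sum_j (fun p : O * T => X j p.1 * eta j p.2)).
  apply: rpredB; first exact/sqintP.
  by apply: rpred_sum => j _; apply/sqintP; apply: L2_tensor => //; exact: L2space_L2.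
by apply/funext => p; rewrite fctE /= fct_sumE.
Qed.

(** The residual [gfun] is read in two ways: [G f] is its section at a fixed [f], an element of
    [L2space nu], and [g x] its section at a fixed [x], an element of [L2space mu]. The second is
    the data of the recursion. *)
Let g x : L2space mu := toL2 (gx2 x).

Let ip_g (h : L2space mu) x : ip h (g x) = \int[mu]_f (h f * gfun f x).
Proof. by []. Qed.

Let eps2 := \int[mu]_f ip (G f) (G f).

Let ipGE f : ip (G f) (G f) = \int[nu]_x (gfun f x ^+ 2).
Proof. by apply: eq_Rintegral => x _; rewrite GE expr2. Qed.

Let L1_ipG : L1 mu (fun f => ip (G f) (G f)).
Proof.
under eq_fun do rewrite ipGE.
by apply: L1_fubini g2.2 _ => f; exact: (gT2 f).2.
Qed.

Let r2 x := ip (g x) (g x).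

Let r2E x : r2 x = \int[mu]_f (gfun f x ^+ 2).
Proof. by apply: eq_Rintegral => f _; rewrite expr2. Qed.

Let L1r2 : L1 nu r2.
Proof.
rewrite (_ : r2 = fun x => \int[mu]_f (gfun f x ^+ 2)); last exact/funext.
apply: (L1_fubini (L1_prod_swap (F := fun f x => gfun f x ^+ 2) g2.2)) => x.
exact: (gx2 x).2.
Qed.

Let eps2E : \int[nu]_x r2 x = eps2.
Proof.
under eq_Rintegral do rewrite r2E.
rewrite -(Rint_fubini g2.2) => [|f|x]; [|exact: (gT2 f).2|exact: (gx2 x).2].
by apply: eq_Rintegral => f _; rewrite ipGE.
Qed.

Let eps2_ge0 : 0 <= eps2.
Proof. by apply: Rint_ge0 => f; exact: form_ge0 (@ip_psd _ _ _ nu) _. Qed.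

Let hg_prod j (h : L2space mu) :
  L1 (mu \x nu)%E (fun p => eta j p.2 * (h p.1 * gfun p.1 p.2)).
Proof.
under eq_fun do rewrite mulrA (mulrC (eta _ _)).
by apply: L2M => //; apply: L2_tensor; exact: L2space_L2.
Qed.

Let L1etag j (h : L2space mu) : L1 nu (fun x => eta j x * ip h (g x)).
Proof.
rewrite (_ : (fun x => _) = (fun x => \int[mu]_f (eta j x * (h f * gfun f x)))).
  apply: (L1_fubini (L1_prod_swap
    (F := fun f x => eta j x * (h f * gfun f x)) (hg_prod j h))) => x.
  by apply: L1Z; apply: L2M => //; exact: L2space_L2.
by apply/funext => x; rewrite RintZ//; apply: L2M => //; exact: L2space_L2.
Qed.

(** After exchanging the integrals, the inner one is [ip (G f) (eta j)], which vanishes because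
    [G f] is a projection residual. *)
Let etag0 j (h : L2space mu) : \int[nu]_x (eta j x * ip h (g x)) = 0.
Proof.
have L1h x : L1 mu (fun f => h f * gfun f x).
  by apply: L2M => //; exact: L2space_L2.
have L1e f : L1 nu (fun x => eta j x * gfun f x).
  by apply: L2M => //; exact: L2space_L2.
transitivity (\int[nu]_x \int[mu]_f (eta j x * (h f * gfun f x))).
  by apply: eq_Rintegral => x _; rewrite RintZ.
rewrite -(Rint_fubini (hg_prod j h)); last 2 first.
- by move=> f; under eq_fun do rewrite mulrCA; exact: L1Z.
- by move=> x; exact: L1Z.
transitivity (\int[mu]_f (h f * ip (G f) (eta j))).
  apply: eq_Rintegral => f _; rewrite /ip -RintZ.
    by apply: eq_Rintegral => x _; rewrite GE; ring.
  by under eq_fun do rewrite GE mulrC; exact: L1e.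
rewrite (_ : (fun f => _) = cst 0); last first.
  by apply/funext => f; rewrite proj_residual_orth ?mulr0//; exact: ip_psd.
by rewrite Rintegral_cst// mul0r.
Qed.

Lemma projection_sampling n t : (0 < k)%N -> (0 < n)%N ->
  67 * k%:R * ln (2 * n%:R) <= n%:R :> R -> 0 < t ->
  exists (xs : 'I_n -> T) (a : 'I_n -> L2space nu),
    (forall i, D (xs i)) /\
    (\int[mu]_f \int[nu]_x ((e f x - \sum_i e f (xs i) * a i x) ^+ 2)%:E <=
     (eps2 + 4 * (k%:R * (eps2 + t)) / n%:R)%:E)%E.
Proof.
move=> k0 n0 kn t0.
have kR : 0 < k%:R :> R by rewrite ltr0n.
have et0 : 0 < eps2 + t by rewrite ltr_wpDl.
pose nn x := \sum_j (eta j x : R) ^+ 2.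
(* The mean of two probability densities, [A] proportional to [|eta|^2] and [C] to [r2 + t]; the
   shift [t] makes it positive everywhere. *)
pose om x := (nn x / k%:R + (r2 x + t) / (eps2 + t)) / 2.
have nn0 x : 0 <= nn x by apply: sumr_ge0 => j _; exact: sqr_ge0.
have r20 x : 0 <= r2 x by exact: form_ge0 (@ip_psd _ _ _ mu) _.
pose A x := nn x / k%:R; pose C x := (r2 x + t) / (eps2 + t).
have A0 x : 0 <= A x by rewrite divr_ge0.
have C0 x : 0 < C x by rewrite divr_gt0// ltr_wpDl.
have omE x : om x = (A x + C x) / 2 by [].
have L1nn : L1 nu nn.
  by apply: L1_sum => j; exact: (L2space_L2 (eta j)).2.
have L1A : L1 nu A by rewrite /A; under eq_fun do rewrite mulrC; exact: L1Z.
have L1C : L1 nu C.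
  rewrite /C; under eq_fun do rewrite mulrC; apply: L1Z.
  by apply: L1D => //; exact: L1_cst.
have iA : \int[nu]_x A x = 1.
  under eq_Rintegral do rewrite /A mulrC; rewrite RintZ// Rint_sum; last first.
    by move=> j; exact: (L2space_L2 (eta j)).2.
  rewrite (eq_bigr (fun=> 1)) => [|j _]; last first.
    transitivity (ip (eta j) (eta j)); last by rewrite eo eqxx.
    by apply: eq_Rintegral => x _; rewrite expr2.
  by rewrite sumr_const card_ord mulVf// gt_eqF.
have L1t : L1 nu (fun=> t) := L1_cst nu t.
have iC : \int[nu]_x C x = 1.
  under eq_Rintegral do rewrite /C mulrC; rewrite RintZ; last exact: L1D.
  rewrite (RintD L1r2 L1t) eps2E Rint_cst.
  by rewrite mulVf// gt_eqF.
have om0 x : 0 < om x by rewrite omE; have := A0 x; have := C0 x; lra.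
have eta_om x : nn x <= 2 * k%:R * om x.
  have -> : nn x = k%:R * A x by rewrite /A mulrC divfK// gt_eqF.
  by rewrite omE; have := C0 x; nra.
(* [A C <= ((A + C) / 2)^2], the inequality of arithmetic and geometric means; it determines
   [q = k (eps2 + t)]. *)
have etag_om x : nn x * r2 x <= k%:R * (eps2 + t) * om x ^+ 2.
  have -> : nn x = k%:R * A x by rewrite /A mulrC divfK// gt_eqF.
  have h1 : r2 x <= (eps2 + t) * C x.
    by rewrite /C mulrC divfK ?gt_eqF// lerDl ltW.
  rewrite -[_ * A x * _]mulrA -[_ * (eps2 + t) * _]mulrA ler_pM2l//.
  apply: (le_trans (ler_wpM2l (A0 x) h1)).
  rewrite mulrCA ler_pM2l// omE.
  have := sqr_ge0 (A x - C x); lra.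
have L1om : L1 nu om.
  rewrite /om; under eq_fun do rewrite mulrC; apply: L1Z; exact: L1D.
have iom : \int[nu]_x om x = 1.
  under eq_Rintegral do rewrite /om mulrC; rewrite RintZ; last exact: L1D.
  by rewrite RintD// iA iC; lra.
have [xs [w [Dxs wex wle]]] := @sampling_weights _ T R nu _ _ (@ip_psd _ _ _ mu) D k n
  (fun j x => eta j x) g om (k%:R * (eps2 + t)) k0 mD nuD om0 eta_om etag_om L1om iom
  (fun i j => L1_ip (eta i) (eta j)) eo L1etag etag0 n0 (mulr_gt0 kR et0) kn.
exists xs, (fun i => \sum_j w i j *: eta j); split => //.
pose y j : L2space mu := \sum_i w i j *: g (xs i).
have yE j f : y j f = \sum_i w i j * gfun f (xs i) by rewrite l2fun_sum.
(* Pythagoras for fixed [f]: the residual [G f] is orthogonal to the span, and the remaining error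
   is the noise [y] inside the span. *)
have errE f : (\int[nu]_x ((e f x - \sum_i e f (xs i) * (\sum_j w i j *: eta j) x) ^+ 2)%:E
    = (ip (G f) (G f) + \sum_j y j f ^+ 2)%:E)%E.
  pose v : L2space nu := G f + \sum_j (- y j f) *: eta j.
  have -> : ip (G f) (G f) + \sum_j y j f ^+ 2 = ip v v.
    rewrite /v (form_pythagoras (@ip_psd _ _ _ nu)) //.
      by congr (_ + _); apply: eq_bigr => j _; rewrite sqrrN.
    by move=> j; apply: proj_residual_orth => //; exact: ip_psd.
  rewrite EFin_ip; apply: eq_integral => x _; congr ((_ ^+ 2)%:E).
  have weE j : \sum_i w i j * e f (xs i) = X j f + y j f.
    have -> : X j f = \sum_l X l f * (\sum_i w i j * eta l (xs i)).
      rewrite (bigD1 j)//= wex eqxx mulr1 big1 ?addr0// => l lj.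
      by rewrite wex eq_sym (negbTE lj) mulr0.
    under [X in _ = X + _]eq_bigr do rewrite mulr_sumr.
    rewrite exchange_big/= yE -big_split/=; apply: eq_bigr => i _.
    rewrite /gfun mulrBr mulr_sumr addrC -addrA [X in _ + X](_ : _ = 0) ?addr0//.
    apply/eqP; rewrite addrC subr_eq0; apply/eqP; apply: eq_bigr => l _; ring.
  have -> : \sum_i e f (xs i) * (\sum_j w i j *: eta j) x =
      \sum_j (X j f + y j f) * eta j x.
    under eq_bigr do rewrite l2fun_sum mulr_sumr.
    rewrite exchange_big; apply: eq_bigr => j _; rewrite -weE mulr_suml.
    by apply: eq_bigr => i _; rewrite l2funZ; ring.
  rewrite /v l2funD l2fun_sum GE /gfun.
  under [X in _ = _ + X]eq_bigr do rewrite l2funZ mulNr.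
  rewrite sumrN -addrA -opprD; congr (_ - _); rewrite -big_split/=.
  by apply: eq_bigr => j _; rewrite mulrDl.
under eq_integral do rewrite errE.
have L1y : L1 mu (fun f => \sum_j y j f ^+ 2).
  by apply: L1_sum => j; exact: (L2space_L2 (y j)).2.
rewrite -EFin_Rint; last exact: L1D.
rewrite lee_fin RintD// lerD2l Rint_sum; last first.
  by move=> j; exact: (L2space_L2 (y j)).2.
apply: le_trans wle; rewrite le_eqVlt; apply/orP; left; apply/eqP.
by apply: eq_bigr => j _; apply: eq_Rintegral => f _; rewrite expr2.
Qed.

Lemma projection_error_le m (h : 'I_m -> L2space nu) (c : 'I_m -> O -> R) :
  (forall i, ip (proj_residual (@ip _ _ _ nu) eta (h i))
     (proj_residual (@ip _ _ _ nu) eta (h i)) = 0) ->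
  (forall i, measurable_fun setT (c i)) ->
  (eps2%:E <= \int[mu]_f \int[nu]_x ((e f x - \sum_i c i f * h i x) ^+ 2)%:E)%E.
Proof.
move=> he mc; rewrite /eps2 EFin_Rint//.
apply: ge0_le_integral => //.
- by move=> f _; rewrite lee_fin (form_ge0 (@ip_psd _ _ _ nu)).
- exact: measurable_int L1_ipG.
- apply: (measurable_fun_fubini_tonelli_F
    (fun p : O * T => ((e p.1 p.2 - \sum_i c i p.1 * h i p.2) ^+ 2)%:E)).
    apply/measurable_EFinP/measurable_funX/measurable_funB => //.
    apply: measurable_sum => i; apply: measurable_funM.
      exact: measurableT_comp (mc i) measurable_fst.
    exact: measurableT_comp (L2space_L2 (h i)).1 measurable_snd.
  by move=> p; rewrite lee_fin sqr_ge0.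
move=> f _.
have := proj_residual_le (@ip_psd _ _ _ nu) (E f) (c^~ f) eo he.
rewrite -/(G f) -lee_fin => /le_trans; apply.
rewrite EFin_ip le_eqVlt; apply/orP; left; apply/eqP; apply: eq_integral => x _.
by rewrite l2funB l2fun_sum.
Qed.

End projection.

Theorem sampling_approximation m n (h : 'I_m -> L2space nu) (c : 'I_m -> O -> R) t :
  (0 < n)%N -> 67 * m%:R * ln (2 * n%:R) <= n%:R :> R -> 0 < t ->
  (forall i, measurable_fun setT (c i)) ->
  exists (xs : 'I_n -> T) (a : 'I_n -> L2space nu),
    (forall i, D (xs i)) /\
    (\int[mu]_f \int[nu]_x ((e f x - \sum_i e f (xs i) * a i x) ^+ 2)%:E <=
     (1 + 4 * m%:R / n%:R)%:E *
       \int[mu]_f \int[nu]_x ((e f x - \sum_i c i f * h i x) ^+ 2)%:E + t%:E)%E.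
Proof.
move=> n0 mn t0 mc.
have nR : 1 <= n%:R :> R by rewrite ler1n.
have [k [eta [km eo he]]] := gram_schmidt (@ip_psd _ _ _ nu) h.
have := projection_error_le eo he mc; set eps2 := Rintegral _ _ _ => epsle.
have eps0 : 0 <= eps2 by apply: Rint_ge0 => f; exact: form_ge0 (@ip_psd _ _ _ nu) _.
have c0 : 0 <= 1 + 4 * m%:R / n%:R :> R by rewrite addr_ge0// divr_ge0.
set E2 := (\int[mu]_f _)%E in epsle *.
have epsle' : ((eps2 + 4 * m%:R / n%:R * eps2 + t)%:E <=
    (1 + 4 * m%:R / n%:R)%:E * E2 + t%:E)%E.
  rewrite EFinD leeD2r//.
  have -> : eps2 + 4 * m%:R / n%:R * eps2 = (1 + 4 * m%:R / n%:R) * eps2 by ring.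
  by rewrite EFinM lee_wpmul2l.
have m4 : 0 <= 4 * m%:R / n%:R * eps2 by rewrite mulr_ge0// divr_ge0.
(* If [k = 0], all [h i] are null and the zero approximation is best: any point of [D] with zero
   weights will do, and [D] is nonempty since it has probability 1. *)
have [k0|k0] := posnP k.
  have [x Dx] : exists x, D x.
    apply: contrapT => nD; move: nuD; rewrite (_ : ~` D = setT).
      by rewrite probability_setT => -[] /eqP; rewrite oner_eq0.
    by apply/seteqP; split => // x _ Dx; apply: nD; exists x.
  exists (fun=> x), (fun=> 0); split => //; apply: le_trans epsle'.
  apply: (@le_trans _ _ eps2%:E); last by rewrite lee_fin; lra.
  subst k; rewrite /eps2 EFin_Rint; last first.
    have := L1_fubini e2.2 (fun f => (eT f).2).
    rewrite (_ : (fun f => _) = fun f => ip (proj_residual (@ip _ _ _ nu) eta (toL2 (eT f)))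
      (proj_residual (@ip _ _ _ nu) eta (toL2 (eT f))))//.
    by apply/funext => f; rewrite /proj_residual big_ord0 subr0.
  rewrite le_eqVlt; apply/orP; left; apply/eqP; apply: eq_integral => f _.
  rewrite /proj_residual big_ord0 subr0 EFin_ip; apply: eq_integral => y _.
  by rewrite big1 ?subr0// => i _; rewrite mulr0.
have mR : k%:R <= m%:R :> R by rewrite ler_nat.
have L0 : 1 <= ln (2 * n%:R) :> R.
  by apply: (@ln2n_ge1 _ m) => //; exact: leq_trans km.
have kn : 67 * k%:R * ln (2 * n%:R) <= n%:R :> R.
  by apply: le_trans mn; rewrite ler_wpM2r//; lra.
have [xs [a [Dxs err]]] := projection_sampling eo k0 n0 kn t0.
exists xs, a; split => //; apply: (le_trans err); apply: le_trans epsle'.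
rewrite lee_fin -/eps2 -addrA lerD2l.
have n1 : 0 < n%:R :> R by lra.
have -> : 4 * (k%:R * (eps2 + t)) / n%:R = 4 * k%:R / n%:R * eps2 + 4 * k%:R / n%:R * t.
  by field; rewrite gt_eqF.
apply: lerD.
  by rewrite ler_wpM2r// ler_wpM2r ?invr_ge0; lra.
(* The slack is multiplied by [4 k / n], which is at most 1. *)
rewrite ler_piMl//; first exact: ltW.
rewrite ler_pdivrMr// mul1r; apply: le_trans kn.
have : 0 <= k%:R :> R by [].
nra.
Qed.

End approximation.

(** * Trigonometric polynomials and the Cramer-Wold device *)

Section trigonometric_polynomials.
Context {R : realType} (n : nat).
Implicit Types h : ('I_n -> R) -> R.

(** The phase [ph] lets cosines alone span all real trigonometric polynomials, sines included. Their
    expectations carry the information of the characteristic function within the reals. *)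
Inductive trig_poly : (('I_n -> R) -> R) -> Prop :=
| trig_cos c t ph : trig_poly (fun y => c * cos (\sum_i t i * y i + ph))
| trig_add h1 h2 : trig_poly h1 -> trig_poly h2 ->
    trig_poly (fun y => h1 y + h2 y).

Lemma trig_poly_cst c : trig_poly (fun=> c).
Proof.
suff -> : (fun=> c) = (fun y : 'I_n -> R => c * cos (\sum_i 0 * y i + 0)).
  exact: trig_cos.
by apply/funext => y; rewrite big1 ?addr0 ?cos0 ?mulr1// => i _; rewrite mul0r.
Qed.

Lemma trig_poly_mul h1 h2 : trig_poly h1 -> trig_poly h2 ->
  trig_poly (fun y => h1 y * h2 y).
Proof.
move=> H1 H2; elim: H1 => [c t ph|f1 f2 _ IH1 _ IH2]; last first.
  by under eq_fun do rewrite mulrDl; exact: trig_add.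
elim: H2 => [c' t' ph'|f1 f2 _ IH1 _ IH2]; last first.
  by under eq_fun do rewrite mulrDr; exact: trig_add.
have -> : (fun y : 'I_n -> R => c * cos (\sum_i t i * y i + ph) *
      (c' * cos (\sum_i t' i * y i + ph'))) =
    (fun y => c * c' / 2 * cos (\sum_i (t i + t' i) * y i + (ph + ph'))
            + c * c' / 2 * cos (\sum_i (t i - t' i) * y i + (ph - ph'))).
  apply/funext => y.
  under [X in _ = _ * cos (X + _) + _]eq_bigr do rewrite mulrDl.
  under [X in _ = _ + _ * cos (X + _)]eq_bigr do rewrite mulrBl.
  rewrite big_split/= sumrB.
  set a := \sum_i t i * y i; set b := \sum_i t' i * y i.
  have -> : a + b + (ph + ph') = (a + ph) + (b + ph') by ring.
  have -> : a - b + (ph - ph') = (a + ph) - (b + ph') by ring.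
  by move: (a + ph) (b + ph') => A A'; rewrite cosD cosB; field.
by apply: trig_add; exact: trig_cos.
Qed.

Lemma trig_poly_exp h N : trig_poly h -> trig_poly (fun y => h y ^+ N).
Proof.
move=> H; elim: N => [|N IHN].
  by under eq_fun do rewrite expr0; exact: trig_poly_cst.
by under eq_fun do rewrite exprS; exact: trig_poly_mul.
Qed.

Lemma trig_poly_sin i (a K : R) : trig_poly (fun y => sin ((y i - a) / K)).
Proof.
suff -> : (fun y : 'I_n -> R => sin ((y i - a) / K)) =
    (fun y => 1 * cos (\sum_j ((j == i)%:R / K) * y j + (- (a / K) - pi / 2))).
  exact: trig_cos.
apply/funext => y; rewrite (bigD1 i)//= eqxx big1 => [|j /negbTE ->].
  by rewrite addr0 mul1r addrA cosBpihalf; congr sin; rewrite mulrBl mul1r mulrC.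
by rewrite !mul0r.
Qed.

End trigonometric_polynomials.

Section sign_kernel.
Context {R : realType}.
Implicit Types x u s : R.

Lemma bernoulli_ineq x N : -1 <= x -> 1 + N%:R * x <= (1 + x) ^+ N.
Proof.
move=> x1; elim: N => [|N IHN]; first by rewrite mul0r addr0 expr0.
rewrite exprS; have := ler_wpM2l (_ : 0 <= 1 + x) IHN => /(_ ltac:(lra)).
apply: le_trans; rewrite -natr1.
have : 0 <= N%:R * x ^+ 2 by rewrite mulr_ge0 ?sqr_ge0.
lra.
Qed.

(** With [s = sqrt u], Bernoulli and [(2 - s) s <= 1] bound [N s^N] by [1 / (1 - s)]; the other
    factor [s^N] tends to 0. *)
Lemma cvg_natmul_expr u : 0 <= u < 1 -> N%:R * u ^+ N @[N --> \oo] --> (0 : R).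
Proof.
move=> /andP[u0 u1]; set s := Num.sqrt u.
have s0 : 0 <= s := sqrtr_ge0 u.
have us : u = s ^+ 2 by rewrite sqr_sqrtr.
have s1 : s < 1 by move: u1; rewrite us; nra.
have Ns N : N%:R * s ^+ N <= (1 - s)^-1.
  rewrite -[leRHS]mul1r ler_pdivlMr; last lra.
  have := @bernoulli_ineq (1 - s) N ltac:(lra).
  move=> /(ler_wpM2r (exprn_ge0 N s0)).
  rewrite -exprMn => h.
  have : ((1 + (1 - s)) * s) ^+ N <= 1.
    by apply: exprn_ile1; [rewrite mulr_ge0//; lra|nra].
  have := exprn_ge0 N s0; nra.
apply: (@squeeze_cvgr _ _ _ _ (fun=> 0) (fun N => (1 - s)^-1 * s ^+ N)).
- apply: nearW => N; rewrite mulr_ge0 ?exprn_ge0//= us -exprM mul2n -addnn exprD.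
  by rewrite mulrA; apply: ler_wpM2r; [exact: exprn_ge0|exact: Ns].
- exact: cvg_cst.
- have := @cvg_geometric R (1 - s)^-1 s; apply; rewrite ger0_norm//.
Qed.

(** A polynomial as in elementary proofs of the Stone-Weierstrass theorem. With [u = (1 - s) / 2]
    and exponent [M = N 2^N], [M u^N = N (2 u)^N] tends to 0 if [u < 1/2] and is at least [N] if
    [u >= 1/2]. The extra factor [N] in [M] settles the boundary case [s = 0]. *)
Definition sign_kernel (N : nat) s : R := (1 - ((1 - s) / 2) ^+ N) ^+ (N * 2 ^ N)%N.

Lemma sign_kernel_itv N s : -1 <= s <= 1 -> 0 <= sign_kernel N s <= 1.
Proof.
move=> /andP[s1 s2].
have u0 : 0 <= ((1 - s) / 2) ^+ N by rewrite exprn_ge0//; lra.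
have u1 : ((1 - s) / 2) ^+ N <= 1 by rewrite exprn_ile1//; lra.
by rewrite exprn_ge0 ?exprn_ile1//; lra.
Qed.

Lemma cvg_sign_kernel s : -1 <= s <= 1 ->
  sign_kernel N s @[N --> \oo] --> ((0 < s)%R%:R : R).
Proof.
move=> s11; have /andP[s1 s2] := s11; set u := (1 - s) / 2.
have u0 : 0 <= u by rewrite /u; lra.
have u1 : u <= 1 by rewrite /u; lra.
have MuE N : (N * 2 ^ N)%N%:R * u ^+ N = N%:R * (2 * u) ^+ N :> R.
  by rewrite natrM natrX [(2 * u) ^+ N]exprMn mulrA.
have [s0|s0] := ltP 0 s.
  apply: (@squeeze_cvgr _ _ _ _ (fun N => 1 - N%:R * (2 * u) ^+ N) (fun=> 1)).
  - apply: nearW => N; have /andP[_ ->] := sign_kernel_itv N s11; rewrite andbT.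
    rewrite -MuE -mulrN; apply: bernoulli_ineq.
    by rewrite lerN2 exprn_ile1.
  - rewrite -[X in _ --> X]subr0; apply: cvgB; first exact: cvg_cst.
    by apply: cvg_natmul_expr; rewrite /u; lra.
  - exact: cvg_cst.
apply: (@squeeze_cvgr _ _ _ _ (fun=> 0) (fun N => expR (- N%:R))).
- apply: nearW => N; have /andP[-> _] := sign_kernel_itv N s11 => /=.
  apply: (@le_trans _ _ (expR (- u ^+ N) ^+ (N * 2 ^ N))).
    apply: lerXn2r; rewrite ?nnegrE ?expR_ge0//; last exact: expR_ge1Dx.
    by rewrite subr_ge0 exprn_ile1.
  rewrite -expRM_natl ler_expR mulrN lerN2 MuE ler_peMr// exprn_ege1//.
  by rewrite /u; lra.
- exact: cvg_cst.
- exact: cvgn_expR.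
Qed.

(** Once [K + 1 > |x|], the argument lies strictly between [- pi] and [pi], where sine has the sign
    of its argument. This removes the periodicity of the approximating functions. *)
Lemma cvg_sin_gt0 (x : R) :
  ((0 < sin (x / K.+1%:R))%R%:R : R) @[K --> \oo] --> ((0 < x)%R%:R : R).
Proof.
apply: cvg_near_cst; near=> K.
have xK : `|x| < K.+1%:R.
  near: K; exists (Num.truncn `|x|) => // K /= NK.
  by apply: (lt_le_trans (truncnS_gt _)); rewrite ler_nat ltnS.
have K0 : 0 < K.+1%:R :> R by rewrite ltr0n.
have pi2 := @pi_ge2 R.
have bd : `|x| / K.+1%:R < pi.
  by rewrite ltr_pdivrMr//; have := normr_ge0 x; nra.
congr ((_ : bool)%:R); case: (ltgtP x 0) => [x0|x0|->].
- apply/negbTE; rewrite -leNgt -[x]opprK mulNr sinN oppr_le0.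
  apply: sin_ge0_pi; rewrite divr_ge0 ?oppr_ge0 ?ltW//=.
  by rewrite -(ltr0_norm x0).
- by apply: sin_gt0_pi; rewrite divr_gt0//= -(gtr0_norm x0).
- by rewrite mul0r sin0 ltxx.
Unshelve. all: by end_near. Qed.

End sign_kernel.

Lemma measurable_mktuple d (T : measurableType d) (R : realType) n
    (Z : 'I_n -> T -> R) :
  (forall i, measurable_fun setT (Z i)) ->
  measurable_fun setT (fun w => [tuple Z i w | i < n]).
Proof.
move=> mZ; apply/measurable_fun_tnthP => i.
rewrite (_ : _ \o _ = Z i)//.
by apply/funext => w /=; rewrite tnth_mktuple.
Qed.

(** * Joint laws from the laws of linear combinations *)

Section cramer_wold.
Context d (T : measurableType d) (R : realType) (P : probability T R) (n : nat).
Variables X Y : 'I_n -> T -> R.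
Hypotheses (mX : forall i, measurable_fun setT (X i))
  (mY : forall i, measurable_fun setT (Y i)).
Hypothesis XY : forall (t : 'I_n -> R) ph,
  \int[P]_w cos (\sum_i t i * X i w + ph) = \int[P]_w cos (\sum_i t i * Y i w + ph).

Let X' w i := X i w.
Let Y' w i := Y i w.

Definition agree (h : ('I_n -> R) -> R) :=
  [/\ L1 P (fun w => h (X' w)), L1 P (fun w => h (Y' w))
    & \int[P]_w h (X' w) = \int[P]_w h (Y' w)].

Let L1_cos (Z : 'I_n -> T -> R) t ph : (forall i, measurable_fun setT (Z i)) ->
  L1 P (fun w => cos (\sum_i t i * Z i w + ph)).
Proof.
move=> mZ; apply: (@L1_le _ _ _ _ (cst 1)).
- apply: measurableT_comp.
    by apply: continuous_measurable_fun; exact: continuous_cos.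
  apply: measurable_funD => //; apply: measurable_sum => i.
  exact: measurable_funM.
- by move=> x; exact: cos_max.
- exact: finite_measure_integrable_cst.
Qed.

Lemma agree_trig h : trig_poly h -> agree h.
Proof.
elim=> [c t ph|h1 h2 _ [X1 Y1 E1] _ [X2 Y2 E2]].
  split; [exact/L1Z/L1_cos|exact/L1Z/L1_cos|].
  by rewrite !RintZ; [rewrite XY|exact: L1_cos|exact: L1_cos].
by split; [exact: L1D|exact: L1D|rewrite !RintD// E1 E2].
Qed.

Lemma agree_lim (h_ : nat -> ('I_n -> R) -> R) h : (forall N, agree (h_ N)) ->
  (forall N y, `|h_ N y| <= 1) -> (forall y, h_ N y @[N --> \oo] --> h y) ->
  agree h.
Proof.
move=> ah h1 hc.
have lim (Z : T -> 'I_n -> R) : (forall N, L1 P (fun w => h_ N (Z w))) ->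
    L1 P (fun w => h (Z w)) /\
    (\int[P]_w (h_ N (Z w))%:E)%E @[N --> \oo] --> (\int[P]_w (h (Z w))%:E)%E.
  move=> LZ; have mh_ N := L1_measurable (LZ N).
  have mh : measurable_fun setT (fun w => h (Z w)).
    by apply: (measurable_fun_cvg _ (fun w _ => hc (Z w))).
  have [] := @dominated_convergence _ _ _ P setT measurableT
    (fun N w => (h_ N (Z w))%:E) (fun w => (h (Z w))%:E) (cst 1%:E).
  - by move=> N; exact/measurable_EFinP.
  - exact/measurable_EFinP.
  - by apply: aeW => w _; apply: cvg_EFin => //; [exact: nearW|exact: hc].
  - exact: finite_measure_integrable_cst.
  - by apply: aeW => w N _; rewrite lee_fin.
  by [].
have [LX cX] := lim _ (fun N => let: And3 a _ _ := ah N in a).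
have [LY cY] := lim _ (fun N => let: And3 _ a _ := ah N in a).
split=> //; apply: EFin_inj; rewrite !EFin_Rint//.
have E : (fun N => \int[P]_w (h_ N (X' w))%:E)%E =
    (fun N => \int[P]_w (h_ N (Y' w))%:E)%E.
  by apply/funext => N; case: (ah N) => LXN LYN EN; rewrite -!EFin_Rint// EN.
rewrite E in cX; exact: (cvg_unique _ cX cY).
Qed.

(** A double limit: for fixed [K] the kernels of the sines are trigonometric polynomials converging
    to indicators of positive sines, and [K] tending to infinity replaces each sine by its argument.
    All functions are bounded by 1, so dominated convergence applies twice. *)
Lemma agree_orthant (s : seq ('I_n * R)) :
  agree (fun y => \prod_(p <- s) (p.2 < y p.1)%R%:R).
Proof.
have prod_cvg (F : nat -> 'I_n * R -> R) (G : 'I_n * R -> R) :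
    (forall p, F N p @[N --> \oo] --> G p) ->
    \prod_(p <- s) F N p @[N --> \oo] --> \prod_(p <- s) G p.
  move=> FG; elim: (s) => [|p s' IHs].
    by under eq_fun do rewrite big_nil; rewrite big_nil; exact: cvg_cst.
  under eq_fun do rewrite big_cons.
  by rewrite big_cons; apply: cvgM => //; exact: FG.
have prod_itv (F : 'I_n * R -> R) : (forall p, 0 <= F p <= 1) ->
    `|\prod_(p <- s) F p| <= 1.
  move=> F01; rewrite normr_prod; apply: prodr_ile1 => p _.
  by have /andP[F0 F1] := F01 p; rewrite ger0_norm ?F0.
apply: (@agree_lim (fun K y => \prod_(p <- s)
  (0 < sin ((y p.1 - p.2) / K.+1%:R))%R%:R)).
- move=> K; apply: (@agree_lim (fun N y => \prod_(p <- s)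
    sign_kernel N (sin ((y p.1 - p.2) / K.+1%:R)))).
  + move=> N; apply: agree_trig; elim: (s) => [|p s' IHs].
      by under eq_fun do rewrite big_nil; exact: trig_poly_cst.
    under eq_fun do rewrite big_cons; apply: trig_poly_mul => //.
    apply: trig_poly_exp; under eq_fun do rewrite -mulN1r.
    apply: trig_add; first exact: trig_poly_cst.
    apply: trig_poly_mul; first exact: trig_poly_cst.
    apply: trig_poly_exp; under eq_fun do rewrite mulrC -mulN1r mulrDr.
    apply: trig_add; first exact: trig_poly_cst.
    apply: trig_poly_mul; first exact: trig_poly_cst.
    apply: trig_poly_mul; first exact: trig_poly_cst.
    exact: trig_poly_sin.
  + by move=> N y; apply: prod_itv => p; apply: sign_kernel_itv; rewrite sin_geN1 sin_le1.
  + by move=> y; apply: prod_cvg => p; apply: cvg_sign_kernel; rewrite sin_geN1 sin_le1.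
- by move=> K y; apply: prod_itv => p; rewrite ler0n lern1 leq_b1.
- move=> y; apply: prod_cvg => p; rewrite -subr_gt0.
  exact: cvg_sin_gt0.
Qed.

(** Indexed by lists of constraints, so that intersection is concatenation and the whole space is
    the empty list: a pi-system by construction. *)
Let orthant (s : seq ('I_n * R)) : set (n.-tuple R) :=
  [set y | forall p, p \in s -> p.2 < tnth y p.1].

Lemma measurable_tuple_orthants :
  @measurable _ (n.-tuple R) = <<s range orthant >>.
Proof.
apply/seteqP; split=> [A mA|]; last first.
  apply: smallest_sub; first exact: sigma_algebra_measurable.
  move=> _ [s _ <-]; elim: s => [|p s IHs].
    by rewrite (_ : orthant [::] = setT)//; apply/seteqP; split => // y _ p.
  rewrite (_ : orthant (p :: s) =
      (fun y => tnth y p.1) @^-1` `]p.2, +oo[ `&` orthant s); last first.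
    apply/seteqP; split=> [y h|y [/= h1 h2] q].
      split=> [|q qs]; last by apply: h; rewrite inE qs orbT.
      by rewrite /= in_itv/= andbT; apply: h; rewrite mem_head.
    by rewrite inE => /predU1P[->|/h2//]; move: h1; rewrite in_itv/= andbT.
  apply: measurableI => //; rewrite -[X in measurable X]setTI.
  by apply: measurable_tnth => //; exact: measurable_itv.
have mid : measurable_fun [set: g_sigma_algebraType (range orthant)]
    (fun y => y : n.-tuple R).
  apply/measurable_fun_tnthP => i.
  apply: (measurability _ (RGenOInfty.measurableE R)) => _ [_ [a ->] <-].
  apply: sub_sigma_algebra; exists [:: (i, a)] => //.
  apply/seteqP; split=> [y /(_ (i, a) (mem_head _ _))/= h|y [_ /=]].
    by split => //=; rewrite in_itv/= andbT.
  by rewrite in_itv/= andbT => h p; rewrite inE => /eqP ->.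
by have := mid measurableT A mA; rewrite setTI.
Qed.

Let Xt w := [tuple X i w | i < n].
Let Yt w := [tuple Y i w | i < n].

Let orthantE (Z : 'I_n -> T -> R) s : (forall i, measurable_fun setT (Z i)) ->
  P ((fun w => [tuple Z i w | i < n]) @^-1` orthant s) =
  (\int[P]_w (\prod_(p <- s) ((p.2 < Z p.1 w)%R%:R : R))%:E)%E.
Proof.
move=> mZ; set A := _ @^-1` _.
have mA : measurable A.
  rewrite /A -[X in measurable X]setTI; apply: measurable_mktuple => //.
  by rewrite measurable_tuple_orthants; apply: sub_sigma_algebra; exists s.
rewrite -[LHS]mul1e -integral_cst//= integral_mkcond.
apply: eq_integral => w _; rewrite patchE; case: ifPn => wA.
  rewrite big_seq big1 // => p ps; move: wA; rewrite inE => /(_ _ ps).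
  by rewrite tnth_mktuple => ->.
congr EFin; apply/esym/eqP; rewrite prodf_seq_eq0.
apply: contraNT wA => /hasPn h; rewrite inE => p ps.
by rewrite tnth_mktuple; have := h p ps; rewrite /= pnatr_eq0 eqb0 negbK.
Qed.

Lemma cramer_wold (A : set (n.-tuple R)) : measurable A ->
  P (Xt @^-1` A) = P (Yt @^-1` A).
Proof.
have mXt := measurable_mktuple mX; have mYt := measurable_mktuple mY.
apply: (@measure_unique _ _ _ (range orthant) (fun=> setT)
   measurable_tuple_orthants _ _ _ (pushforward P Xt) (pushforward P Yt)) => //.
- move=> _ _ [s _ <-] [s' _ <-]; exists (s ++ s') => //.
  apply/seteqP; split=> [y h|y [h1 h2] p].
    by split=> p ps; apply: h; rewrite mem_cat ps ?orbT.
  by rewrite mem_cat => /orP[/h1|/h2].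
- by move=> _; exists [::] => //; apply/seteqP; split => // y _ p.
- by rewrite bigcup_const//; exists 0%N.
- move=> _ [s _ <-].
  transitivity (P (Xt @^-1` orthant s)) => //.
  transitivity (P (Yt @^-1` orthant s)) => //.
  rewrite [LHS](orthantE s mX) [RHS](orthantE s mY).
  have [LX LY E] := agree_orthant s.
  by rewrite -!EFin_Rint// E.
- move=> _; have : (P setT < +oo)%E by rewrite probability_setT ltry.
  by [].
Qed.

Lemma cramer_wold_integral (f : n.-tuple R -> \bar R) :
  measurable_fun setT f -> (forall y, 0 <= f y)%E ->
  (\int[P]_w f (Xt w) = \int[P]_w f (Yt w))%E.
Proof.
move=> mf f0; have mXt := measurable_mktuple mX; have mYt := measurable_mktuple mY.
rewrite -(ge0_integral_pushforward mXt P (D := setT))//.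
rewrite -(ge0_integral_pushforward mYt P (D := setT))//.
by apply: eq_measure_integral => A mA _; exact: cramer_wold.
Qed.

End cramer_wold.

(** * Gaussian variables *)

Section density.
Context d (T : measurableType d) (R : realType) (m : {measure set T -> \bar R}).
Variable p : T -> R.
Hypotheses (mp : measurable_fun setT p) (p0 : forall x, 0 <= p x).

Definition density_measure (A : set T) : \bar R := (\int[m]_(x in A) (p x)%:E)%E.

Let density0 : density_measure set0 = 0%E.
Proof. exact: integral_set0. Qed.

Let density_ge0 A : (0 <= density_measure A)%E.
Proof. by apply: integral_ge0 => x _; rewrite lee_fin. Qed.

Let density_sigma_additive : semi_sigma_additive density_measure.
Proof.
move=> F mF tF mUF; rewrite /density_measure; apply: cvg_toP.
  apply: ereal_nondecreasing_is_cvgn => a b ab.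
  by apply: lee_sum_nneg_natr => // i _ _; exact: density_ge0.
rewrite ge0_integral_bigcup//=; first exact/measurable_EFinP/measurable_funTS.
by move=> x _; rewrite lee_fin.
Qed.

HB.instance Definition _ := isMeasure.Build _ _ _ density_measure
  density0 density_ge0 density_sigma_additive.

Definition density_prob (p1 : density_measure setT = 1%E) : probability T R :=
  HB.pack density_measure
    (@Measure_isProbability.Build _ _ _ density_measure p1).

Import HBNNSimple.

Lemma integral_density (nu : {measure set T -> \bar R}) (f : T -> \bar R) :
  (forall A, measurable A -> nu A = density_measure A) ->
  measurable_fun setT f -> (forall x, 0 <= f x)%E ->
  (\int[nu]_x f x = \int[m]_x (f x * (p x)%:E))%E.
Proof.
move=> nuE mf f0; pose h := nnsfun_approx measurableT mf.
have mEp : measurable_fun setT (EFin \o p) by exact/measurable_EFinP.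
have -> : (\int[nu]_x f x = lim (\int[nu]_x (h n x)%:E @[n --> \oo]))%E.
  have fE x : f x = lim ((h n x)%:E @[n --> \oo]).
    by apply/esym/cvg_lim => //; exact: cvg_nnsfun_approx.
  under eq_integral do rewrite fE.
  apply: monotone_convergence => //.
  - by move=> n; exact/measurable_EFinP.
  - by move=> n x _; rewrite lee_fin.
  - by move=> x _ a b ab; rewrite lee_fin; exact/lefP/nd_nnsfun_approx.
have -> : (\int[m]_x (f x * (p x)%:E) =
    lim (\int[m]_x ((h n x)%:E * (p x)%:E) @[n --> \oo]))%E.
  have fE x : (f x * (p x)%:E = lim (((h n x)%:E * (p x)%:E)%E @[n --> \oo]))%E.
    apply/esym/cvg_lim => //; apply: cvgeZr => //.
    exact: cvg_nnsfun_approx.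
  under eq_integral do rewrite fE.
  apply: monotone_convergence => //.
  - by move=> n; apply: emeasurable_funM => //; exact/measurable_EFinP.
  - by move=> n x _; rewrite mule_ge0 ?lee_fin.
  - move=> x _ a b ab; rewrite lee_wpmul2r ?lee_fin//.
    exact/lefP/nd_nnsfun_approx.
congr (lim (_ @ \oo)); apply/funext => n.
under eq_integral do rewrite fimfunE -fsumEFin//.
rewrite ge0_integral_fsum//; last 2 first.
- by move=> r; exact/measurable_EFinP/measurableT_comp.
- by move=> r x _; rewrite EFinM nnfun_muleindic_ge0.
under [RHS]eq_integral => x _.
  rewrite fimfunE -fsumEFin// ge0_mule_fsuml; last first.
    by move=> r; exact: nnfun_muleindic_ge0.
  over.
rewrite ge0_integral_fsum//; last 2 first.
- move=> r; apply: emeasurable_funM => //.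
  by apply/measurable_EFinP/measurableT_comp.
- by move=> r x _; apply: mule_ge0; [exact: nnfun_muleindic_ge0|rewrite lee_fin].
apply: eq_fsbigr => r /set_mem[t _ htr].
have r0 : 0 <= r by rewrite -htr.
under eq_integral do rewrite EFinM.
under [RHS]eq_integral do rewrite EFinM -muleA.
rewrite ge0_integralZl//; last first.
  exact/measurable_EFinP.
rewrite [RHS]ge0_integralZl//; last 2 first.
- by apply: emeasurable_funM => //; exact/measurable_EFinP.
- by move=> x _; rewrite mule_ge0 ?lee_fin.
congr (_ * _)%E; rewrite integral_indic// setIT nuE// /density_measure.
rewrite integral_mkcond; apply: eq_integral => x _.
rewrite patchE indicE; case: ifPn => xA; first by rewrite mul1e.
by rewrite mul0e.
Qed.

End density.

Section normal_moments.
Context {R : realType}.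
Implicit Types s : R.
Local Notation leb := (@lebesgue_measure R).

Definition normal_m2 s : \bar R := (\int[leb]_x (x ^+ 2 * normal_pdf 0 s x)%:E)%E.

Lemma normal_m2_scale s : s != 0 -> normal_m2 s = ((s ^+ 2)%:E * normal_m2 1)%E.
Proof.
move=> s0; have as0 : 0 < `|s| by rewrite normr_gt0.
pose G (y : R) : R := y ^+ 2 * normal_pdf 0 1 y.
pose F (x : R^o) : R^o := x * `|s|^-1.
have F' : F^`()%classic = cst `|s|^-1.
  apply/funext => x; rewrite /F derive1E deriveM//.
  by rewrite derive_cst scaler0 add0r derive_id scaler1.
have G0 x : 0 <= G x by rewrite mulr_ge0 ?sqr_ge0 ?normal_pdf_ge0.
have cG : continuous G.
  move=> x; apply: cvgM; first exact: exprn_continuous.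
  by apply: continuous_normal_pdf; exact: oner_neq0.
have mG : measurable_fun setT G by exact: continuous_measurable_fun.
rewrite /normal_m2 -/(G _).
have -> : (\int[leb]_x (x ^+ 2 * normal_pdf 0 1 x)%:E =
    \int[leb]_x (((G \o F) * F^`()%classic) x)%:E)%E.
  apply: increasing_ge0_integration_by_substitutionT => //.
  - by move=> x y xy; rewrite /F ltr_pM2r// invr_gt0.
  - by rewrite F' => x; exact: cvg_cst.
  - by rewrite F'; exact: is_cvg_cst.
  - by rewrite F'; exact: is_cvg_cst.
  - by apply: gt0_cvgMlNy; [rewrite invr_gt0|exact: cvg_id].
  - by apply: gt0_cvgMly; [rewrite invr_gt0|exact: cvg_id].
rewrite F' -ge0_integralZl//; last 3 first.
- apply/measurable_EFinP/measurable_funM => //.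
  by apply: measurableT_comp => //; exact: measurable_funM.
- by move=> x _; rewrite lee_fin mulr_ge0 ?invr_ge0//; exact: G0.
- by rewrite lee_fin sqr_ge0.
apply: eq_integral => x _; rewrite -EFinM; congr EFin.
rewrite !fctE /G /F /= /normal_pdf oner_eq0 (negbTE s0) /normal_peak /normal_fun.
rewrite !subr0 expr1n mul1r.
have -> : (x / `|s|) ^+ 2 = x ^+ 2 / s ^+ 2.
  by rewrite exprMn exprVn real_normK ?num_real.
have -> : - (x ^+ 2 / s ^+ 2) / (1 *+ 2) = - x ^+ 2 / (s ^+ 2 *+ 2).
  by field.
rewrite -mulrnAr sqrtrM ?sqr_ge0// sqrtr_sqr.
have : 0 < Num.sqrt (pi *+ 2 : R) by rewrite sqrtr_gt0 mulrn_wgt0// pi_gt0.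
by move: (Num.sqrt _) => b b0; field; rewrite s0 !gt_eqF.
Qed.

Lemma normal_m2_1_lty : (normal_m2 1 < +oo)%E.
Proof.
have s2 : Num.sqrt 2 != 0 :> R by rewrite gt_eqF// sqrtr_gt0.
pose c : R := 4 * normal_peak 1 / normal_peak (Num.sqrt 2).
have c0 : 0 <= c by rewrite mulr_ge0 ?invr_ge0 ?mulr_ge0// normal_peak_ge0.
apply: (@le_lt_trans _ _ (\int[leb]_x (c%:E * (normal_pdf 0 (Num.sqrt 2) x)%:E))%E).
  apply: ge0_le_integral => //.
  - by move=> x _; rewrite lee_fin mulr_ge0 ?sqr_ge0 ?normal_pdf_ge0.
  - apply/measurable_EFinP/measurable_funM; first exact: measurable_funX.
    exact: measurable_normal_pdf.
  - apply/measurable_EFinP/measurable_funM => //; exact: measurable_normal_pdf.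
  move=> x _; rewrite lee_fin /normal_pdf oner_eq0 (negbTE s2) /c.
  rewrite [leRHS]mulrA divfK ?gt_eqF ?normal_peak_gt0//.
  (* With [y = x^2 / 4] this reads [4 y exp (- 2 y) <= 4 exp (- y)], that is [y <= exp y]; the right
     side is a multiple of the normal density of variance 2. *)
  have key : x ^+ 2 * normal_fun 0 1 x <= 4 * normal_fun 0 (Num.sqrt 2) x.
    rewrite /normal_fun !subr0 expr1n sqr_sqrtr//.
    have -> : - x ^+ 2 / (1 *+ 2) = - (x ^+ 2 / 4) + - (x ^+ 2 / 4) by field.
    have -> : - x ^+ 2 / (2 *+ 2) = - (x ^+ 2 / 4) by field.
    rewrite expRD mulrA ler_wpM2r ?expR_ge0//.
    have -> : x ^+ 2 = 4 * (x ^+ 2 / 4) by field.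
    rewrite -mulrA ler_piMr//; set y := x ^+ 2 / 4.
    rewrite (_ : 4 * y / 4 = y); last by field.
    have : y * expR (- y) <= expR y * expR (- y).
      by rewrite ler_wpM2r ?expR_ge0//; have := expR_ge1Dx y; lra.
    by rewrite expRxMexpNx_1.
  have := ler_wpM2l (normal_peak_ge0 1) key; lra.
rewrite ge0_integralZl//; last 2 first.
- by apply/measurable_EFinP; exact: measurable_normal_pdf.
- by move=> x _; rewrite lee_fin normal_pdf_ge0.
by rewrite integral_normal_pdf mule1 ltry.
Qed.

(** The density is at most [1 / (|s| sqrt (2 pi))] on an interval of length [|s|], and
    [2 pi >= 4]. *)
Lemma normal_small_ball s : s != 0 ->
  (normal_prob 0 s [set` `[- (`|s| / 2), `|s| / 2]%R] <= (2^-1)%:E)%E.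
Proof.
move=> s0; have as0 : 0 < `|s| by rewrite normr_gt0.
rewrite /normal_prob; set I := [set` _].
have mI : measurable I by exact: measurable_itv.
apply: (@le_trans _ _ (\int[leb]_(x in I) (normal_peak s)%:E)%E).
  apply: ge0_le_integral => //.
  - by move=> x _; rewrite lee_fin normal_pdf_ge0.
  - by apply/measurable_EFinP/measurable_funTS; exact: measurable_normal_pdf.
  - by move=> x _; rewrite lee_fin normal_pdf_ub.
rewrite integral_cst//= lebesgue_measure_itv/= lte_fin.
have -> : - (`|s| / 2) < `|s| / 2 by lra.
rewrite -EFinD -EFinM lee_fin opprK -splitr /normal_peak.
rewrite -mulrnAr sqrtrM ?sqr_ge0// sqrtr_sqr invfM mulrC mulrA mulfV ?gt_eqF// mul1r.
rewrite lef_pV2 ?posrE//; last by rewrite sqrtr_gt0 mulrn_wgt0// pi_gt0.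
rewrite -[leLHS](@ger0_norm _ 2)// -sqrtr_sqr ler_wsqrtr// -mulr_natr.
by have := @pi_ge2 R; lra.
Qed.

End normal_moments.

Lemma integral_density_law d d' (O : measurableType d) (T : measurableType d')
    (R : realType) (mu : {measure set O -> \bar R}) (m : {measure set T -> \bar R})
    (p : T -> R) (Z : O -> T) (f : T -> \bar R) :
  measurable_fun setT p -> (forall x, 0 <= p x) -> measurable_fun setT Z ->
  (forall A, measurable A -> mu (Z @^-1` A) = density_measure m p A) ->
  measurable_fun setT f -> (forall x, 0 <= f x)%E ->
  (\int[mu]_w f (Z w) = \int[m]_x (f x * (p x)%:E))%E.
Proof.
move=> mp p0 mZ lawZ mf f0.
transitivity (\int[pushforward mu Z]_x f x)%E.
  by rewrite (ge0_integral_pushforward mZ mu (D := setT)).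
by apply: integral_density => //; exact: lawZ.
Qed.

Section gaussian_variables.
Context d (O : measurableType d) (R : realType) (mu : probability O R).
Implicit Types Z : O -> R.

Definition centered_normal_law Z s : Prop :=
  forall A : set R, measurable A ->
    mu (Z @^-1` A) = if s == 0 then \d_(0 : R) A else normal_prob 0 s A.

Definition gaussian_rv Z := measurable_fun setT Z /\ exists s, centered_normal_law Z s.

(** The second moment of the standard normal law, kept as a symbol: in comparisons of second moments
    it cancels or enters a finite constant. *)
Definition normal_c2 : R := fine (normal_m2 (1 : R)).

Lemma normal_m2E s : s != 0 -> normal_m2 s = (s ^+ 2 * normal_c2)%:E.
Proof.
move=> s0; rewrite normal_m2_scale// [RHS]EFinM; congr (_ * _)%E.
rewrite /normal_c2 fineK// ge0_fin_numE ?normal_m2_1_lty//.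
by apply: integral_ge0 => x _; rewrite lee_fin mulr_ge0 ?sqr_ge0 ?normal_pdf_ge0.
Qed.

Lemma integral_gaussian_sqr Z s : measurable_fun setT Z -> centered_normal_law Z s ->
  (\int[mu]_f (Z f ^+ 2)%:E = (s ^+ 2 * normal_c2)%:E)%E.
Proof.
move=> mZ Zs; have msq : measurable_fun setT (fun x : R => (x ^+ 2)%:E).
  exact/measurable_EFinP/measurable_funX.
have sq0 (x : R) : (0 <= (x ^+ 2)%:E)%E by rewrite lee_fin sqr_ge0.
have [s0|s0] := eqVneq s 0.
  have Z0 : {ae mu, forall f, Z f = 0}.
    have mZ0 : measurable (Z @^-1` [set 0]).
      by rewrite -[X in measurable X]setTI; exact: mZ.
    exists (~` (Z @^-1` [set 0])); split => //; first exact: measurableC.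
    rewrite probability_setC// Zs// s0 eqxx diracE mem_set//=.
    by rewrite subee.
  rewrite (ae_eq_integral (cst 0%E)) ?integral0 ?s0 ?expr0n ?mul0r//.
    by apply/measurable_EFinP/measurable_funX.
  by apply: filterS Z0 => f /= -> _; rewrite expr0n.
transitivity (\int[lebesgue_measure]_x ((x ^+ 2)%:E * (normal_pdf 0 s x)%:E))%E.
  apply: (@integral_density_law _ _ _ (measurableTypeR R) _ mu lebesgue_measure
    (normal_pdf 0 s) Z (fun x => (x ^+ 2)%:E)) => //.
  - exact: measurable_normal_pdf.
  - exact: normal_pdf_ge0.
  - by move=> A mA; have := Zs _ mA; rewrite (negbTE s0).
by rewrite -normal_m2E.
Qed.

Lemma gaussian_L2 Z : gaussian_rv Z -> L2 mu Z.
Proof.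
move=> [mZ [s Zs]]; split=> //; apply: L1_ge0P => [|x|].
- exact: measurable_funX.
- exact: sqr_ge0.
- by rewrite (integral_gaussian_sqr mZ Zs) ltry.
Qed.

Lemma normal_c2_ge0 : 0 <= normal_c2.
Proof.
apply: fine_ge0; apply: integral_ge0 => x _.
by rewrite lee_fin mulr_ge0 ?sqr_ge0 ?normal_pdf_ge0.
Qed.

(** Outside an event of probability at most [1/2], [Z^2] is at least [s^2 / 4]. Within [A] this
    leaves probability [9/10 - 1/2 = 2/5], and [1/4 * 2/5 = 1/10]. *)
Lemma gaussian_small_ball Z s (A : set O) :
  measurable_fun setT Z -> centered_normal_law Z s -> s != 0 -> measurable A ->
  ((9 / 10)%:E <= mu A)%E ->
  ((s ^+ 2 / 10)%:E <= \int[mu]_(f in A) (Z f ^+ 2)%:E)%E.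
Proof.
move=> mZ Zs s0 mA muA; set I := [set` `[- (`|s| / 2), `|s| / 2]%R] : set R.
have mI : measurable I by exact: measurable_itv.
have mZI : measurable (Z @^-1` I) by rewrite -[X in measurable X]setTI; exact: mZ.
have muI : (mu (Z @^-1` I) <= (2^-1)%:E)%E.
  by rewrite Zs// (negbTE s0); exact: normal_small_ball.
have mAI : measurable (A `\` Z @^-1` I) by exact: measurableD.
have muAI : ((2 / 5)%:E <= mu (A `\` Z @^-1` I))%E.
  have : (mu A <= mu (A `\` Z @^-1` I) + mu (Z @^-1` I))%E.
    apply: (@le_trans _ _ (mu (A `\` Z @^-1` I `|` Z @^-1` I))); last exact: measureU2.
    apply: le_measure; rewrite ?inE//; first exact: measurableU.
    by move=> x Ax; have [h|h] := pselect ((Z @^-1` I) x); [right|left].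
  have f1 : mu (A `\` Z @^-1` I) \is a fin_num by exact: fin_num_measure.
  have f2 : mu (Z @^-1` I) \is a fin_num by exact: fin_num_measure.
  move: muI muA; rewrite -(fineK f1) -(fineK f2) -EFinD => h1 h2 /(le_trans h2).
  by rewrite !lee_fin in h1 *; lra.
apply: (@le_trans _ _ (\int[mu]_(f in A `\` Z @^-1` I) (s ^+ 2 / 4)%:E)%E).
  rewrite integral_cst//.
  apply: (@le_trans _ _ ((s ^+ 2 / 4)%:E * (2 / 5)%:E)%E).
    by rewrite -EFinM lee_fin; have := sqr_ge0 s; lra.
  by apply: lee_wpmul2l => //; rewrite lee_fin divr_ge0 ?sqr_ge0.
apply: (@le_trans _ _ (\int[mu]_(f in A `\` Z @^-1` I) (Z f ^+ 2)%:E)%E).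
  apply: ge0_le_integral => //.
  - by move=> f _; rewrite lee_fin divr_ge0 ?sqr_ge0.
  - by apply/measurable_EFinP/measurable_funTS; exact: measurable_funX.
  move=> f [_]; rewrite /I /= in_itv/= => /negP; rewrite -ler_norml -ltNge => h.
  rewrite lee_fin -[s ^+ 2]real_normK ?num_real// -[Z f ^+ 2]real_normK ?num_real//.
  have -> : `|s| ^+ 2 / 4 = (`|s| / 2) ^+ 2 by field.
  by apply: lerXn2r; rewrite ?nnegrE ?divr_ge0// ltW.
apply: ge0_subset_integral => //.
- by apply/measurable_EFinP/measurable_funTS; exact: measurable_funX.
- by move=> f _; rewrite lee_fin sqr_ge0.
Qed.

(** The constant is the same for all [Z], so the bound can later be integrated over all evaluations
    [e^~ x] with one event [A]. *)
Lemma gaussian_m2_le_trunc Z (A : set O) : gaussian_rv Z -> measurable A ->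
  ((9 / 10)%:E <= mu A)%E ->
  (\int[mu]_f (Z f ^+ 2)%:E <=
   (10 * normal_c2)%:E * \int[mu]_(f in A) (Z f ^+ 2)%:E)%E.
Proof.
move=> [mZ [s Zs]] mA muA; rewrite (integral_gaussian_sqr mZ Zs).
have c0 := normal_c2_ge0.
have [->|s0] := eqVneq s 0.
  rewrite expr0n mul0r mule_ge0 ?lee_fin ?mulr_ge0//.
  by apply: integral_ge0 => x _; rewrite lee_fin sqr_ge0.
have -> : s ^+ 2 * normal_c2 = (10 * normal_c2) * (s ^+ 2 / 10) by field.
rewrite EFinM; apply: lee_wpmul2l; first by rewrite lee_fin mulr_ge0.
exact: gaussian_small_ball.
Qed.

Lemma normal_prob_opp s : normal_prob (0 : R) (- s) = normal_prob 0 s.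
Proof.
rewrite /normal_prob /normal_pdf /normal_peak /normal_fun.
by rewrite oppr_eq0 !sqrrN.
Qed.

Lemma gaussian_eq_law Z Z' : gaussian_rv Z -> gaussian_rv Z' ->
  (\int[mu]_f (Z f ^+ 2)%:E = \int[mu]_f (Z' f ^+ 2)%:E)%E ->
  forall A : set R, measurable A -> mu (Z @^-1` A) = mu (Z' @^-1` A).
Proof.
move=> [mZ [s Zs]] [mZ' [s' Zs']].
rewrite (integral_gaussian_sqr mZ Zs) (integral_gaussian_sqr mZ' Zs') => -[sE] A mA.
rewrite Zs// Zs'//.
(* The second moments give [s^2 = s'^2] once [normal_c2] can be cancelled; a nondegenerate Gaussian
   variable forces it to be nonzero by the small ball estimate on the whole space. *)
have c0 : (s != 0) || (s' != 0) -> normal_c2 != 0.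
  suff c0 W u : measurable_fun setT W -> centered_normal_law W u -> u != 0 ->
      normal_c2 != 0.
    by case/orP; [exact: c0 Zs|exact: c0 Zs'].
  move=> mW Wu u0; apply/eqP => c0.
  have := gaussian_small_ball mW Wu u0 measurableT.
  rewrite probability_setT lee_fin => /(_ ltac:(lra)).
  rewrite (integral_gaussian_sqr mW Wu) c0 mulr0 lee_fin.
  have : 0 < u ^+ 2 by rewrite lt0r sqrf_eq0 u0 sqr_ge0.
  lra.
have [ss|] := boolP ((s != 0) || (s' != 0)).
  have /eqP := mulIf (c0 ss) sE; rewrite eqf_sqr => /orP[/eqP->//|/eqP->].
  by rewrite oppr_eq0 normal_prob_opp.
by rewrite negb_or !negbK => /andP[/eqP-> /eqP->].
Qed.

Lemma gaussian_eq_cos Z Z' ph : gaussian_rv Z -> gaussian_rv Z' ->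
  (\int[mu]_f (Z f ^+ 2)%:E = \int[mu]_f (Z' f ^+ 2)%:E)%E ->
  \int[mu]_f cos (Z f + ph) = \int[mu]_f cos (Z' f + ph).
Proof.
move=> gZ gZ' ZZ'.
have mcosR : measurable_fun setT (fun x : R => cos (x + ph)).
  apply: measurableT_comp; last exact: measurable_funD.
  by apply: continuous_measurable_fun; exact: continuous_cos.
have mcos : measurable_fun setT (fun x : R => (cos (x + ph))%:E).
  exact/measurable_EFinP.
have icos W : measurable_fun setT W -> mu.-integrable (W @^-1` setT)
    ((fun x : R => (cos (x + ph))%:E) \o W).
  move=> mW; rewrite preimage_setT; apply: (@L1_le _ _ _ _ (fun=> 1)).
  - exact: measurableT_comp mcosR mW.
  - by move=> x; exact: cos_max.
  - exact: finite_measure_integrable_cst.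
congr fine.
have [mZ mZ'] := (gZ.1, gZ'.1).
transitivity (\int[pushforward mu Z]_x (cos (x + ph))%:E)%E.
  by rewrite (integral_pushforward mZ mcos (icos _ mZ) measurableT).
transitivity (\int[pushforward mu Z']_x (cos (x + ph))%:E)%E; last first.
  by rewrite (integral_pushforward mZ' mcos (icos _ mZ') measurableT).
by apply: eq_measure_integral => A mA _; exact: gaussian_eq_law.
Qed.

End gaussian_variables.

(** * Linear regression is the best predictor of a Gaussian variable *)

Section gaussian_regression.
Context d (O : measurableType d) (R : realType) (mu : probability O R).
Variables (m : nat) (X : L2space mu) (L : 'I_m -> L2space mu).
Hypothesis gXL : forall a (b : 'I_m -> R),
  gaussian_rv mu (fun f => a * X f + \sum_i b i * L i f).

Let gL i : gaussian_rv mu (L i).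
Proof.
have := gXL 0 (fun j => (j == i)%:R); congr (gaussian_rv _ _).
apply/funext => f; rewrite mul0r add0r (bigD1 i)//= eqxx mul1r big1 ?addr0//.
by move=> j /negbTE ->; rewrite mul0r.
Qed.

Variable c : 'I_m -> R.
Let res : L2space mu := X - \sum_i c i *: L i.
Hypothesis res_orth : forall i, ip res (L i) = 0.

Let resE f : res f = X f - \sum_i c i * L i f.
Proof. by rewrite /res l2funB l2fun_sum. Qed.

(* The residual is uncorrelated with, hence independent of, the observations;
   only the invariance of the joint law under [res |-> - res] is needed. *)
Lemma gaussian_regression (psi : m.-tuple R -> R) : measurable_fun setT psi ->
  (\int[mu]_f ((X f - \sum_i c i * L i f) ^+ 2)%:E <=
   \int[mu]_f ((X f - psi [tuple L i f | i < m]) ^+ 2)%:E)%E.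
Proof.
move=> mpsi.
(* The vector [(s * res, L_1, ..., L_m)], used for [s = 1] and [s = -1]. All its linear combinations
   are Gaussian, so its law is determined by their second moments. *)
pose Z (s : R) (i : 'I_m.+1) (f : O) : R := oapp (L^~ f) (s * res f) (unlift ord0 i).
have Z0 s f : Z s ord0 f = s * res f by rewrite /Z unlift_none.
have ZS s i f : Z s (lift ord0 i) f = L i f by rewrite /Z liftK.
have mres : measurable_fun setT res := (L2space_L2 res).1.
have mZ s i : measurable_fun setT (Z s i).
  case: (unliftP ord0 i) => [j|] ->.
    by rewrite (_ : Z s _ = L j)//; [exact: (gL j).1|exact/funext].
  rewrite (_ : Z s _ = fun f => s * res f); last exact/funext.
  exact: measurable_funM.
have combE s (t : 'I_m.+1 -> R) f : \sum_i t i * Z s i f =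
    (t ord0 * s) * X f + \sum_i (t (lift ord0 i) - t ord0 * s * c i) * L i f.
  rewrite big_ord_recl Z0 resE mulrA mulrBr -addrA; congr (_ + _).
  rewrite mulr_sumr -sumrN -big_split/=; apply: eq_bigr => i _.
  by rewrite ZS; ring.
have gZ s t : gaussian_rv mu (fun f => \sum_i t i * Z s i f).
  rewrite (_ : (fun f => _) = (fun f => (t ord0 * s) * X f +
    \sum_i (t (lift ord0 i) - t ord0 * s * c i) * L i f)); last first.
    by apply/funext => f; exact: combE.
  exact: gXL.
(* Orthogonality removes the cross term, so the sign [s] disappears from the second moment. *)
have m2Z s t : s ^+ 2 = 1 -> (\int[mu]_f ((\sum_i t i * Z s i f) ^+ 2)%:E =
    (t ord0 ^+ 2 * ip res res + ip (\sum_i t (lift ord0 i) *: L i)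
       (\sum_i t (lift ord0 i) *: L i))%:E)%E.
  move=> s1; set S := \sum_i _; have pB := @ip_psd _ _ _ mu.
  have rS : ip res S = 0.
    by rewrite (form_sumr pB) big1// => i _; rewrite (formZr pB) res_orth mulr0.
  have expand a (r u : L2space mu) : ip r u = 0 ->
      ip (a *: r + u) (a *: r + u) = a ^+ 2 * ip r r + ip u u.
    move=> ru; have ur : ip u r = 0 by case: pB => _ -> _.
    rewrite (formDl pB) !(formDr pB) !(formZl pB) !(formZr pB) ru ur; ring.
  pose u := (t ord0 * s) *: res + S.
  have <- : ip u u = t ord0 ^+ 2 * ip res res + ip S S.
    by rewrite expand// exprMn s1 mulr1.
  rewrite EFin_ip; apply: eq_integral => f _; congr ((_ ^+ 2)%:E).
  have -> : u f = t ord0 * s * res f + S f by [].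
  rewrite big_ord_recl Z0 mulrA /S l2fun_sum; congr (_ + _).
  by apply: eq_bigr => i _; rewrite ZS.
pose th (l : m.-tuple R) := \sum_i c i * tnth l i - psi l.
pose bh (y : m.+1.-tuple R) : m.-tuple R := [tuple tnth y (lift ord0 i) | i < m].
pose F (y : m.+1.-tuple R) : \bar R := ((tnth y ord0 + th (bh y)) ^+ 2)%:E.
have mth : measurable_fun setT th.
  apply: measurable_funB => //; apply: measurable_sum => i.
  by apply: measurable_funM => //; exact: measurable_tnth.
have mbh : measurable_fun setT bh.
  apply/measurable_fun_tnthP => i.
  rewrite (_ : _ \o _ = fun y : m.+1.-tuple R => tnth y (lift ord0 i)).
    exact: measurable_tnth.
  by apply/funext => y /=; rewrite tnth_mktuple.
have mF : measurable_fun setT F.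
  apply/measurable_EFinP/measurable_funX/measurable_funD.
    exact: measurable_tnth.
  exact: measurableT_comp mth mbh.
have FE s f : F [tuple Z s i f | i < m.+1] =
    ((s * res f + th [tuple L i f | i < m]) ^+ 2)%:E.
  rewrite /F tnth_mktuple Z0; congr ((_ + th _) ^+ 2)%:E.
  by apply: eq_from_tnth => i; rewrite !tnth_mktuple ZS.
have cw : (\int[mu]_f F [tuple Z 1%R i f | i < m.+1] =
    \int[mu]_f F [tuple Z (-1)%R i f | i < m.+1])%E.
  apply: cramer_wold_integral => //.
  - move=> t ph; apply: gaussian_eq_cos; [exact: gZ|exact: gZ|].
    by rewrite !m2Z ?sqrrN ?expr1n.
  - by move=> y; rewrite lee_fin sqr_ge0.
have mthL : measurable_fun setT (fun f => th [tuple L i f | i < m]).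
  apply: (measurableT_comp mth); apply: measurable_mktuple => i.
  exact: (gL i).1.
have msq s : measurable_fun setT
    (fun f => ((s * res f + th [tuple L i f | i < m]) ^+ 2)%:E).
  apply/measurable_EFinP/measurable_funX/measurable_funD => //.
  exact: measurable_funM.
have E1 : (\int[mu]_f ((X f - psi [tuple L i f | i < m]) ^+ 2)%:E =
    \int[mu]_f ((1 * res f + th [tuple L i f | i < m]) ^+ 2)%:E)%E.
  apply: eq_integral => f _; congr ((_ ^+ 2)%:E).
  rewrite mul1r resE /th; under [X in _ + (X - _)]eq_bigr do rewrite tnth_mktuple.
  by rewrite addrA subrK.
have E2 : (\int[mu]_f ((1 * res f + th [tuple L i f | i < m]) ^+ 2)%:E =
    \int[mu]_f ((-1 * res f + th [tuple L i f | i < m]) ^+ 2)%:E)%E.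
  by under eq_integral do rewrite -FE; under [RHS]eq_integral do rewrite -FE.
have sq0 s f : (0 <= ((s * res f + th [tuple L i f | i < m]) ^+ 2)%:E)%E.
  by rewrite lee_fin sqr_ge0.
(* [psi] is merely measurable, so [J] may be infinite and the mean of [res * th] undefined.
   Averaging the integrands for both signs cancels the cross term pointwise and leaves
   [res^2 + th^2]. *)
rewrite E1; set J := (leRHS).
have half0 : (0 <= (2^-1)%:E :> \bar R)%E by rewrite lee_fin.
have -> : (J = (2^-1)%:E * J + (2^-1)%:E * J)%E.
  have hh : 2^-1 + 2^-1 = 1 :> R by lra.
  by rewrite -ge0_muleDl// -EFinD hh mul1e.
rewrite {2}/J E2 /J -!ge0_integralZl// -ge0_integralD//; last 4 first.
- by move=> f _; rewrite mule_ge0.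
- exact: measurable_funeM.
- by move=> f _; rewrite mule_ge0.
- exact: measurable_funeM.
apply: ge0_le_integral => //.
- by move=> f _; rewrite lee_fin sqr_ge0.
- under eq_fun do rewrite -resE.
  exact/measurable_EFinP/measurable_funX.
- by apply: emeasurable_funD; exact: measurable_funeM.
move=> f _; rewrite -resE -!EFinM -EFinD lee_fin.
have := sqr_ge0 (th [tuple L i f | i < m]); nra.
Qed.

End gaussian_regression.

(** * Measurability of point evaluation and linear functionals *)

Section caratheodory_function.
Context {R : realType} (F : normedModType R) d (T : measurableType d).
Variables (S : set F) (e : F -> T -> R).
Hypotheses (cS : countable S) (dS : closure S = setT).
Hypotheses (ce : forall x, continuous (fun f : F => e f x))
  (me : forall f, measurable_fun setT (e f)).

(* [e] is the pointwise limit of [(f, x) |-> e (s i) x], where [s i] is the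
   first element of a dense sequence at distance less than [1/(k+1)] of [f]. *)
Lemma measurable_caratheodory :
  measurable_fun setT (fun p : borel F * T => e (p.1 : F) p.2).
Proof.
have [f0 Sf0] : S !=set0.
  apply/set0P/eqP => S0; have : closure S 0 by rewrite dS.
  by rewrite S0 closure0.
have [s Ss] : exists s : nat -> F, S `<=` range s.
  have /pfcard_geP[S0|[s]] := cS; first by move: Sf0; rewrite S0.
  by exists s => f Sf; have [i _ <-] := 'surj_s Sf; exists i.
pose near_s k (f : F) := [pred i | `|s i - f| < k.+1%:R^-1].
have exN k f : exists i, near_s k f i.
  have : closure S f by rewrite dS.
  move=> /(_ (ball f k.+1%:R^-1)) [|g [Sg]]; first by apply: nbhsx_ballx; rewrite invr_gt0.
  have [i _ <-] := Ss _ Sg; rewrite -ball_normE /ball_/= => h.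
  by exists i; rewrite /= distrC.
pose N k f := ex_minn (exN k f).
have NP k f : `|s (N k f) - f| < k.+1%:R^-1 by rewrite /N; case: ex_minnP.
have mball i (r : R) : measurable ([set f | `|s i - f| < r] : set (borel F)).
  apply: sub_sigma_algebra; rewrite (_ : [set f | _] = ball (s i) r).
    have [r0|r0] := ltP 0 r; first exact: ball_open.
    rewrite (_ : ball _ _ = set0); first exact: open0.
    by apply/seteqP; split => // f; rewrite -ball_normE /ball_/= ltNge (le_trans r0).
  by rewrite -ball_normE.
have NE k f i : N k f = i <-> near_s k f i /\ forall j, (j < i)%N -> ~~ near_s k f j.
  rewrite /N; case: ex_minnP => n nn nmin; split=> [<-|[ni imin]].
    by split => // j jn; apply/negP => /nmin; rewrite leqNgt jn.
  apply/eqP; rewrite eqn_leq nmin//= leqNgt; apply/negP => /imin.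
  by rewrite nn.
have mN k i : measurable ([set f | N k f = i] : set (borel F)).
  rewrite (_ : [set f | _] = [set f | `|s i - f| < k.+1%:R^-1] `\`
      \bigcup_(j in `I_i) [set f | `|s j - f| < k.+1%:R^-1]).
    apply: measurableD => //; apply: bigcup_measurable => j _; exact: mball.
  apply/seteqP; split => f /=.
    move=> /NE[h1 h2]; split => // -[j /= ji]; exact/negP/h2.
  by move=> [h1 h2]; apply/NE; split => // j ji; apply/negP => h; apply: h2; exists j.
apply: (@measurable_fun_cvg _ _ _ _
  (fun k (p : borel F * T) => e (s (N k (p.1 : F))) p.2)).
  move=> k _ Y mY; rewrite setTI.
  rewrite (_ : _ @^-1` Y = \bigcup_i ([set f | N k f = i] `*` (e (s i) @^-1` Y))).
    apply: bigcup_measurable => i _; apply: measurableX; first exact: mN.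
    by rewrite -[X in measurable X]setTI; exact: me.
  apply/seteqP; split => [[f x] /= h|[f x] [i _ [/= <-]]//].
  by exists (N k f).
move=> [f x] _ /=.
apply: (@cvg_comp _ _ _ (fun k => s (N k f)) (fun g => e g x) _ (nbhs f)); last exact: ce.
apply/cvgrPdist_lt => eps eps0; near=> k.
rewrite distrC (lt_trans (NP _ _))//.
near: k; exact: near_infty_natSinv_lt (PosNum eps0).
Unshelve. all: by end_near. Qed.

End caratheodory_function.

Section clf.
Context {R : realType} {F : normedModType R}.

Lemma is_clf0 : is_clf (fun _ : F => 0 : R).
Proof. by split=> [a f g|f]; [rewrite mulr0 addr0|exact: cvg_cst]. Qed.

Lemma is_clf_comb a (L L' : F -> R) : is_clf L -> is_clf L' ->
  is_clf (fun f => a * L f + L' f).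
Proof.
move=> [lL cL] [lL' cL']; split=> [b f g|f]; first by rewrite lL lL'; ring.
apply: cvgD; last exact: cL'.
by apply: cvgM; [exact: cvg_cst|exact: cL].
Qed.

Lemma is_clf_sum m (b : 'I_m -> R) (L : 'I_m -> F -> R) :
  (forall i, is_clf (L i)) -> is_clf (fun f => \sum_i b i * L i f).
Proof.
move=> cL; elim: (index_enum _) => [|i s IHs].
  by under eq_fun do rewrite big_nil; exact: is_clf0.
by under eq_fun do rewrite big_cons; exact: is_clf_comb.
Qed.

Lemma continuous_measurable_borel (L : F -> R) : continuous L ->
  measurable_fun [set: borel F] (L : borel F -> R).
Proof.
move=> /continuousP cL.
apply: (measurability _ (RGenOInfty.measurableE R)) => _ [_ [a ->] <-].
by rewrite setTI; apply: sub_sigma_algebra; apply: cL; exact: rray_open.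
Qed.

Lemma clf_gaussian (mu : probability (borel F) R) (L : F -> R) :
  zero_mean_gaussian mu -> is_clf L -> gaussian_rv mu (L : borel F -> R).
Proof.
move=> gmu cL; split; first exact: continuous_measurable_borel cL.2.
have [L0|[s [s0 Ls]]] := gmu _ cL.
  by exists 0 => A mA; rewrite eqxx; exact: L0.
by exists s => A mA; rewrite (negbTE s0); exact: Ls.
Qed.

(** Balls of integer radius exhaust the space; [9/10] is the level used in [gaussian_small_ball]. *)
Lemma norm_ball_prob (mu : probability (borel F) R) : exists r : R,
  let A := [set f : borel F | `|f : F| <= r] in
  [/\ 0 <= r, measurable A & ((9 / 10)%:E <= mu A)%E].
Proof.
pose A (n : nat) := [set f : borel F | `|f : F| <= n%:R].
have mn : measurable_fun [set: borel F] (fun f : borel F => `|f : F|).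
  by apply: continuous_measurable_borel; exact: norm_continuous.
have mA n : measurable (A n).
  rewrite (_ : A n = (fun f : borel F => `|f : F|) @^-1` `]-oo, n%:R]).
    by rewrite -[X in measurable X]setTI; apply: mn.
  by apply/seteqP; split => f; rewrite /A /= in_itv.
have UA : \bigcup_n A n = setT.
  apply/seteqP; split => // f _; exists (Num.truncn `|f : F|).+1 => //.
  by rewrite /A /= ltW// truncnS_gt.
have cA : (mu \o A) n @[n --> \oo] --> 1%E.
  rewrite -(probability_setT mu) -UA; apply: nondecreasing_cvg_mu => //.
    by rewrite UA.
  by move=> a b ab; apply/subsetPset => f /= /le_trans; apply; rewrite ler_nat.
have : \forall n \near \oo, 9 / 10 < (fine \o (mu \o A)) n.
  by apply: cvgr_gt (fine_cvg cA) _ _; lra.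
move=> [n _ /(_ n (leqnn n)) /= An]; exists n%:R; split; [by []|exact: mA|].
have fA : mu (A n) \is a fin_num by exact: fin_num_measure.
by rewrite -/(A n) -(fineK fA) lee_fin ltW.
Qed.

End clf.

(** * From an arbitrary algorithm to approximation in a span of [m] functions *)

Section regression_error.
Context d1 d2 (O : measurableType d1) (T : measurableType d2) (R : realType).
Variables (mu : probability O R) (nu : probability T R) (e : O -> T -> R).
Hypotheses (me : measurable_fun setT (fun p : O * T => e p.1 p.2))
  (eO : forall x, L2 mu (e^~ x))
  (efin : (\int[mu]_f \int[nu]_x (e f x ^+ 2)%:E < +oo)%E).
Variables (m : nat) (L : 'I_m -> O -> R) (phi : m.-tuple R -> T -> R).
Hypothesis gXL : forall x a (b : 'I_m -> R),
  gaussian_rv mu (fun f => a * e f x + \sum_i b i * L i f).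
Hypothesis mphi : measurable_fun setT (fun p : m.-tuple R * T => phi p.1 p.2).

Let gL i : gaussian_rv mu (L i).
Proof.
have := gXL point 0 (fun j => (j == i)%:R); congr (gaussian_rv _ _).
apply/funext => f; rewrite mul0r add0r (bigD1 i)//= eqxx mul1r big1 ?addr0//.
by move=> j /negbTE ->; rewrite mul0r.
Qed.

Let LL i : L2space mu := toL2 (gaussian_L2 (gL i)).
Let XX x : L2space mu := toL2 (eO x).
Let h (i : 'I_m) (x : T) : R := ip (XX x) (LL i).

Let e2 : L2 (mu \x nu)%E (fun p => e p.1 p.2).
Proof. exact: L2_prod. Qed.

Let h2 i : L2 nu (h i).
Proof.
have LeL : L1 (mu \x nu)%E (fun p => e p.1 p.2 * LL i p.1).
  apply: L2M => //.
  have := @L2_tensor _ _ _ _ _ mu nu (LL i) (cst 1).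
  under eq_fun do rewrite mulr1; apply; first exact: L2space_L2.
  split; first exact: measurable_cst.
  exact: (L1_cst nu (1 ^+ 2)).
have mh : measurable_fun setT (h i).
  apply: L1_measurable; apply: (L1_fubini (L1_prod_swap
    (F := fun f x => e f x * LL i f) LeL)) => x.
  by apply: L2M; [exact: eO|exact: L2space_L2].
split => //.
have L1X : L1 nu (fun x => \int[mu]_f (e f x ^+ 2)).
  apply: (L1_fubini (L1_prod_swap (F := fun f x => e f x ^+ 2) e2.2)) => x.
  exact: (eO x).2.
apply: (L1_le _ _ (L1Z (ip (LL i) (LL i)) L1X)); first exact: measurable_funX.
move=> x; rewrite ger0_norm ?sqr_ge0// mulrC.
rewrite [X in _ <= X * _](_ : _ = ip (XX x) (XX x)).
  by apply: form_cauchy_schwarz; exact: ip_psd.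
by apply: eq_Rintegral => f _; rewrite expr2.
Qed.

(** Tonelli reduces the claim to a fixed [x], where [phi] at [x] is one predictor of [f(x)] among
    others. The regression coefficients at [x] are the row of covariances [h i x] times [pinvmx Gm];
    regrouping the sum, the dependence on [x] sits in the [m] functions [h i] alone. The
    pseudo-inverse allows dependent functionals. *)
Lemma regression_error : exists (hh : 'I_m -> L2space nu) (c : 'I_m -> O -> R),
  (forall i, measurable_fun setT (c i)) /\
  (\int[mu]_f \int[nu]_x ((e f x - \sum_i c i f * hh i x) ^+ 2)%:E <=
   \int[mu]_f \int[nu]_x ((e f x - phi [tuple L i f | i < m] x) ^+ 2)%:E)%E.
Proof.
pose Gm := \matrix_(a, b) ip (LL a) (LL b).
pose K := pinvmx Gm.
pose c i f := \sum_a K i a * L a f.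
have mL a : measurable_fun setT (L a) := (gL a).1.
have mc i : measurable_fun setT (c i).
  by apply: measurable_sum => a; exact: measurable_funM.
exists (fun i => toL2 (h2 i)), c; split => //.
have m1 : measurable_fun setT
    (fun p : O * T => ((e p.1 p.2 - \sum_i c i p.1 * h i p.2) ^+ 2)%:E).
  apply/measurable_EFinP/measurable_funX/measurable_funB => //.
  apply: measurable_sum => i; apply: measurable_funM.
    exact: measurableT_comp (mc i) measurable_fst.
  exact: measurableT_comp (h2 i).1 measurable_snd.
have mLt : measurable_fun setT (fun f => [tuple L i f | i < m]).
  exact: measurable_mktuple.
have m2 : measurable_fun setT
    (fun p : O * T => ((e p.1 p.2 - phi [tuple L i p.1 | i < m] p.2) ^+ 2)%:E).
  apply/measurable_EFinP/measurable_funX/measurable_funB => //.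
  rewrite (_ : (fun p => _) = (fun q : m.-tuple R * T => phi q.1 q.2) \o
    (fun p : O * T => ([tuple L i p.1 | i < m], p.2)))//.
  apply: measurableT_comp => //; apply: measurable_fun_pair; last exact: measurable_snd.
  exact: measurableT_comp mLt measurable_fst.
rewrite [leLHS](fubini_tonelli _ m1); last by move=> p; rewrite lee_fin sqr_ge0.
rewrite [leRHS](fubini_tonelli _ m2); last by move=> p; rewrite lee_fin sqr_ge0.
apply: ge0_le_integral => //.
- by move=> x _; apply: integral_ge0 => f _; rewrite lee_fin sqr_ge0.
- apply: (measurable_fun_fubini_tonelli_G _ m1).
  by move=> p; rewrite lee_fin sqr_ge0.
- apply: (measurable_fun_fubini_tonelli_G _ m2).
  by move=> p; rewrite lee_fin sqr_ge0.
move=> x _ /=.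
pose cx a := (\row_a ip (XX x) (LL a) *m K) 0 a.
have cxE f : \sum_i c i f * h i x = \sum_a cx a * L a f.
  under eq_bigr do rewrite mulr_suml; rewrite exchange_big/=.
  apply: eq_bigr => a _; rewrite /cx mxE mulr_suml; apply: eq_bigr => i _.
  by rewrite [X in _ = X * _ * _]mxE /h; ring.
under eq_integral do rewrite cxE.
have mpx : measurable_fun setT (fun y => phi y x).
  exact: (measurableT_comp mphi (pair2_measurable x)).
have := @gaussian_regression _ _ _ mu m (XX x) LL (gXL x) cx _ _ mpx; apply => i.
exact: (normal_equations (@ip_psd _ _ _ mu)).
Qed.

End regression_error.

(** * The average case setting *)

Section average_case.
Context {R : realType} (d : nat) (F : completeNormedModType R)
  (lam : {measure set (d.-tuple R) -> \bar R}) (D : set (d.-tuple R))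
  (rho : d.-tuple R -> R) (ev : F -> d.-tuple R -> R)
  (mu : probability (borel F) R).
Hypothesis setting : avg_setting lam D rho ev mu.

Let mD : measurable D. Proof. by case: setting => _ [[]]. Qed.

Let mrho : measurable_fun D rho. Proof. by case: setting => _ [_ [[]]]. Qed.

Let rho0 x : D x -> 0 <= rho x.
Proof. by case: setting => _ [_ [[_ [h _]] _]]; exact: h. Qed.

(** Extension by zero makes [rho dx] a probability on all of [R^d] for which [D] has full
    measure. *)
Let p := rho \_ D.

Let mp : measurable_fun setT p.
Proof. exact/(measurable_restrictT _ mD). Qed.

Let p0 x : 0 <= p x.
Proof. by rewrite /p patchE; case: ifPn => // /set_mem; exact: rho0. Qed.

Let p1 : density_measure lam p setT = 1%E.
Proof.
case: setting => _ [_ [[_ [_ <-]] _]].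
rewrite /density_measure [RHS]integral_mkcond; apply: eq_integral => x _.
by rewrite /p !patchE; case: ifP.
Qed.

Let nu : probability (d.-tuple R) R := density_prob mp p0 p1.

Let nuD : nu (~` D) = 0%E.
Proof.
transitivity (\int[lam]_(x in ~` D) (p x)%:E)%E; first by [].
rewrite (eq_integral (cst 0%E)) ?integral0// => x /set_mem Dx.
by rewrite /p patchE memNset.
Qed.

Let integral_nu (f : d.-tuple R -> R) : measurable_fun setT f -> (forall x, 0 <= f x) ->
  (\int[nu]_x (f x)%:E = \int[lam]_(x in D) (f x * rho x)%:E)%E.
Proof.
move=> mf f0; rewrite (integral_density (m := lam) mp p0 (nu := nu) (f := EFin \o f))//.
- rewrite [RHS]integral_mkcond; apply: eq_integral => x _.
  rewrite patchE /p patchE; case: ifP => _; first by rewrite EFinM.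
  by rewrite mule0.
- exact/measurable_EFinP.
Qed.

(** Outside [D] the setting says nothing about [ev]; with the value 0 there, evaluation at every [x]
    is a continuous linear functional, hence Gaussian. *)
Let e (f : borel F) : d.-tuple R -> R := (ev f) \_ D.

Let mev f : measurable_fun setT (e f).
Proof.
apply/(measurable_restrictT _ mD).
by case: setting => _ [_ [_ [_ [_ [_ [[h _] _]]]]]]; exact: h.
Qed.

Let clf_e x : is_clf (fun f : F => e f x).
Proof.
have [Dx|nDx] := pselect (D x); last first.
  rewrite (_ : (fun f => _) = fun=> 0); first exact: is_clf0.
  by apply/funext => f; rewrite /e patchE memNset.
case: setting => _ [_ [_ [_ [[lin _] [cev _]]]]].
rewrite (_ : (fun f => _) = fun f => ev f x); first by split=> [a f g|]; [exact: lin|exact: cev].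
by apply/funext => f; rewrite /e patchE mem_set.
Qed.

Let gmu : zero_mean_gaussian mu.
Proof. by case: setting => _ [_ [_ [_ [_ [_ []]]]]]. Qed.

Let me : measurable_fun setT (fun q : borel F * d.-tuple R => e q.1 q.2).
Proof.
case: setting => _ [_ [_ [[S [cS dS]] _]]].
by apply: (measurable_caratheodory cS dS) => // x; exact: (clf_e x).2.
Qed.

Let eO x : L2 mu (e^~ x).
Proof. exact/gaussian_L2/(clf_gaussian gmu)/clf_e. Qed.

Let ebound : exists C : R, forall f : F,
  (\int[nu]_x (e f x ^+ 2)%:E <= (C * `|f| ^+ 2)%:E)%E.
Proof.
case: setting => _ [_ [_ [_ [_ [_ [[_ [C hC]] _]]]]]].
exists C => f; apply: le_trans (hC f).
rewrite integral_nu; [|exact: measurable_funX|by move=> x; exact: sqr_ge0].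
rewrite le_eqVlt; apply/orP; left; apply/eqP; apply: eq_integral => x Dx.
by rewrite /e patchE Dx.
Qed.

Let eT f : L2 nu (e f).
Proof.
split=> //; have [C hC] := ebound; apply: L1_ge0P => [|x|].
- exact: measurable_funX.
- exact: sqr_ge0.
- exact: le_lt_trans (hC f) (ltry _).
Qed.

Let sq0 (q : borel F * d.-tuple R) : (0 <= (e q.1 q.2 ^+ 2)%:E)%E.
Proof. by rewrite lee_fin sqr_ge0. Qed.

Let msq : measurable_fun setT (fun q : borel F * d.-tuple R => (e q.1 q.2 ^+ 2)%:E).
Proof. by apply/measurable_EFinP; exact: measurable_funX. Qed.

(* A weak form of Fernique's theorem: on a ball of probability at least 9/10
   the second moment is trivially finite, and each Gaussian variable [e^~ x]
   keeps a fixed fraction of its variance there. *)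
Let efin : (\int[mu]_f \int[nu]_x (e f x ^+ 2)%:E < +oo)%E.
Proof.
have [C hC] := ebound; have [r [r0 mA muA]] := norm_ball_prob mu.
set A := [set f | _] in mA muA.
pose k := 10 * normal_c2 R.
have k0 : 0 <= k by rewrite mulr_ge0// normal_c2_ge0.
pose eA (q : borel F * d.-tuple R) : \bar R := ((\1_A q.1)%:E * (e q.1 q.2 ^+ 2)%:E)%E.
have eA0 q : (0 <= eA q)%E by rewrite mule_ge0// lee_fin.
have meA : measurable_fun setT eA.
  apply: emeasurable_funM => //; apply/measurable_EFinP.
  exact: measurableT_comp (measurable_indic mA) measurable_fst.
have restr (g : borel F -> \bar R) :
    (\int[mu]_(f in A) g f = \int[mu]_f ((\1_A f)%:E * g f))%E.
  rewrite integral_mkcond; apply: eq_integral => f _.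
  by rewrite patchE indicE; case: ifP => _; rewrite ?mul1e ?mul0e.
(* Tonelli brings the integral over [f] inside, where the Gaussian comparison holds for each [x]; a
   second exchange returns to the ball [A], on which [ebound] gives at most [|C| r^2]. *)
apply: (@le_lt_trans _ _ (k%:E * \int[nu]_x \int[mu]_f eA (f, x))%E).
  rewrite (fubini_tonelli _ msq sq0) -ge0_integralZl//; last first.
  - by move=> x _; exact: integral_ge0.
  - exact: (measurable_fun_fubini_tonelli_G _ meA eA0).
  apply: ge0_le_integral => //.
  - by move=> x _; exact: integral_ge0.
  - exact: (measurable_fun_fubini_tonelli_G _ msq sq0).
  - apply: measurable_funeM; exact: (measurable_fun_fubini_tonelli_G _ meA eA0).
  move=> x _; rewrite -restr.
  exact: gaussian_m2_le_trunc (clf_gaussian gmu (clf_e x)) mA muA.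
rewrite -(fubini_tonelli _ meA eA0) lte_mul_pinfty ?lee_fin//.
apply: (@le_lt_trans _ _ (\int[mu]_f (`|C| * r ^+ 2)%:E)%E); last first.
  by rewrite -(EFin_Rint (L1_cst mu _)) ltry.
apply: ge0_le_integral => //.
- by move=> f _; exact: integral_ge0.
- exact: (measurable_fun_fubini_tonelli_F _ meA eA0).
move=> f _; rewrite /eA /= indicE; have [fA|fA] := boolP (f \in A).
  under eq_integral do rewrite mul1e.
  apply: (le_trans (hC f)); rewrite lee_fin.
  have : `|f : F| ^+ 2 <= r ^+ 2.
    by apply: lerXn2r; rewrite ?nnegrE//; move: fA; rewrite inE.
  move=> h; apply: (@le_trans _ _ (`|C| * `|f : F| ^+ 2)).
    by apply: ler_wpM2r; [exact: sqr_ge0|exact: ler_norm].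
  by apply: ler_wpM2l.
under eq_integral do rewrite mul0e.
by rewrite integral0 lee_fin mulr_ge0// sqr_ge0.
Qed.

Let sqerr n (L : 'I_n -> F -> R) (phi : n.-tuple R -> d.-tuple R -> R) : \bar R :=
  (\int[mu]_f \int[lam]_(x in D) ((ev f x - phi (info L f) x) ^+ 2 * rho x)%:E)%E.

Let sqerrE n (L : 'I_n -> F -> R) (phi : n.-tuple R -> d.-tuple R -> R) :
  (forall y, measurable_fun setT (phi y)) ->
  sqerr L phi = (\int[mu]_f \int[nu]_x ((e f x - phi (info L f) x) ^+ 2)%:E)%E.
Proof.
move=> mphi; apply: eq_integral => f _; rewrite integral_nu.
- by apply: eq_integral => x Dx; rewrite /e patchE Dx.
- by apply: measurable_funX; apply: measurable_funB.
- by move=> x; exact: sqr_ge0.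
Qed.

Lemma std_sampling_error m n (L : 'I_m -> F -> R) (phi : m.-tuple R -> d.-tuple R -> R) t :
  (0 < n)%N -> 67 * m%:R * ln (2 * n%:R) <= n%:R :> R -> 0 < t ->
  (forall i, is_clf (L i)) -> admissible_phi lam D rho phi ->
  exists (L' : 'I_n -> F -> R) (phi' : n.-tuple R -> d.-tuple R -> R),
    [/\ forall i, Lambda_std D ev (L' i), admissible_phi lam D rho phi'
      & (sqerr L' phi' <= (1 + 4 * m%:R / n%:R)%:E * sqerr L phi + t%:E)%E].
Proof.
move=> n0 mn t0 clfL [mphi _].
have gXL x a (b : 'I_m -> R) :
    gaussian_rv mu (fun f => a * e f x + \sum_i b i * L i f).
  by apply: (clf_gaussian gmu); apply: is_clf_comb => //; exact: is_clf_sum.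
have [h [c [mc hle]]] := regression_error (nu := nu) me eO efin gXL mphi.
have [xs [a [Dxs err]]] := sampling_approximation mD nuD me eT eO efin h n0 mn t0 mc.
pose phi' (y : n.-tuple R) x := \sum_i tnth y i * a i x.
have phi'E y x : phi' y x = (\sum_i tnth y i *: a i : L2space nu) x.
  by rewrite l2fun_sum.
have mphi'y y : measurable_fun setT (phi' y).
  rewrite (_ : phi' y = (\sum_i tnth y i *: a i : L2space nu)); last first.
    by apply/funext => x; rewrite phi'E.
  exact: (L2space_L2 _).1.
exists (fun i f => ev f (xs i)), phi'; split.
- by move=> i; exists (xs i); split.
- split.
    apply: measurable_sum => i; apply: measurable_funM.
      exact: measurableT_comp (measurable_tnth i) measurable_fst.
    exact: measurableT_comp (L2space_L2 (a i)).1 measurable_snd.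
  move=> y; rewrite -integral_nu; [|exact: measurable_funX|by move=> x; exact: sqr_ge0].
  have := (L2space_L2 (\sum_i tnth y i *: a i : L2space nu)).2.
  under eq_fun do rewrite -phi'E.
  move=> h2; rewrite -(EFin_Rint h2); exact: ltry.
rewrite sqerrE// sqerrE; last first.
  by move=> y; exact: (measurableT_comp mphi (pair1_measurable y)).
apply: (@le_trans _ _ (\int[mu]_f \int[nu]_x ((e f x - \sum_i e f (xs i) * a i x) ^+ 2)%:E)%E).
  rewrite le_eqVlt; apply/orP; left; apply/eqP.
  apply: eq_integral => f _; apply: eq_integral => x _; congr ((_ - _) ^+ 2)%:E.
  apply: eq_bigr => i _; rewrite tnth_mktuple /e patchE mem_set//.
by apply: (le_trans err); rewrite leeD2r// lee_wpmul2l.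
Qed.

End average_case.

(** The limit in the slack is taken after squaring, where the slack is a plain additive term. *)
Lemma sqrte_le_addgt0 {R : realType} (x y : \bar R) :
  (0 <= y)%E -> (forall t : R, 0 < t -> (x <= sqrte (y + t%:E))%E) -> (x <= sqrte y)%E.
Proof.
move=> y0 h; have [x0|x0] := leP x 0%E; first exact: le_trans x0 (sqrte_ge0 _).
have xE : x = sqrte (x ^+ 2)%E by rewrite sqrte_sqr gee0_abs// ltW.
rewrite xE lee_sqrt//; apply/lee_addgt0Pr => t t0.
have yt : (0 <= y + t%:E)%E by rewrite adde_ge0// lee_fin ltW.
by have := h t t0; rewrite {1}xE lee_sqrt.
Qed.

Lemma sampling_budget {R : realType} (delta : R) (m n : nat) :
  0 < delta < 1 -> (0 < m)%N ->
  (m%:Z = Num.floor (n%:R / (48 * (Num.sqrt 2 * ln (2 * n%:R) - ln delta)))) ->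
  (0 < n)%N /\ 67 * m%:R * ln (2 * n%:R) <= n%:R :> R.
Proof.
move=> /andP[d0 d1] m0 mE.
(* For [n = 0] the quotient is 0 and so is its floor, against [m >= 1]. *)
have n0 : (0 < n)%N.
  rewrite lt0n; apply/eqP => n0; move: mE; rewrite n0 mul0r floor0 => -[mE].
  by rewrite mE in m0.
split=> //; have n1 : 1 <= n%:R :> R by rewrite ler1n.
have L0 : 0 <= ln (2 * n%:R) :> R by rewrite ln_ge0//; lra.
have ld : ln delta < 0 by apply: ln_lt0; rewrite d0.
(* [48 * 7/5 = 67.2], which is where 67 comes from. *)
have s2 : 7 / 5 <= Num.sqrt 2 :> R.
  rewrite -(@ger0_norm _ (7 / 5)); last lra.
  by rewrite -sqrtr_sqr ler_wsqrtr//; lra.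
set b := 48 * _ in mE.
have b1 : 67 * ln (2 * n%:R) <= b by rewrite /b; nra.
have b0 : 0 < b.
  have : 0 <= Num.sqrt 2 * ln (2 * n%:R) :> R by rewrite mulr_ge0// sqrtr_ge0.
  rewrite /b; lra.
have := floor_le (n%:R / b); rewrite -mE ler_pdivlMr// => h.
apply: le_trans h; rewrite mulrAC mulrC; apply: ler_wpM2l => //.
Qed.

Theorem theorem2p1 (R : realType) (delta : R) (m n : nat) :
  0 < delta < 1 ->
  (0 < m)%N ->
  (m%:Z = Num.floor (n%:R / (48 * (Num.sqrt 2 * ln (2 * n%:R) - ln delta))))%R ->
  forall (d : nat) (F : completeNormedModType R)
    (lam : {measure set (d.-tuple R) -> \bar R}) (D : set (d.-tuple R))
    (rho : d.-tuple R -> R) (ev : F -> d.-tuple R -> R)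
    (mu : probability (borel F) R),
  avg_setting lam D rho ev mu ->
  (e_avg mu lam D rho ev n (Lambda_std D ev)
   <= ((Num.sqrt (1 + 4 * m%:R / n%:R) / Num.sqrt (1 - delta))%:E
       * e_avg mu lam D rho ev m Lambda_all))%E.
Proof.
move=> delta01 m0 mE d F lam D rho ev mu setting.
have [n0 mn] := sampling_budget delta01 m0 mE.
have /andP[d0 d1] := delta01.
set c := Num.sqrt _ / Num.sqrt _.
have a0 : 0 < 1 + 4 * m%:R / n%:R :> R by rewrite ltr_pwDl// divr_ge0.
have s0 : 0 < Num.sqrt (1 + 4 * m%:R / n%:R) :> R by rewrite sqrtr_gt0.
have sd0 : 0 < Num.sqrt (1 - delta) by rewrite sqrtr_gt0; lra.
have sd1 : Num.sqrt (1 - delta) <= 1.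
  by rewrite -[leRHS]sqrtr1 ler_wsqrtr//; lra.
have c0 : 0 < c by rewrite divr_gt0.
have cge : Num.sqrt (1 + 4 * m%:R / n%:R) <= c.
  by rewrite /c ler_pdivlMr// ler_piMr// ltW.
(* Selects the infimum branch of [e_avg], since both [m] and [n] are positive. *)
have e_avgE k (Lam : set (F -> R)) : (0 < k)%N -> e_avg mu lam D rho ev k Lam =
  ereal_inf [set e | exists (L : 'I_k -> F -> R)
                           (phi : k.-tuple R -> d.-tuple R -> R),
                 (forall i, Lam (L i)) /\ admissible_phi lam D rho phi /\
                 e = err_avg mu lam D rho ev L phi].
  by case: k.
(* Moving the positive constant to the left leaves a bare infimum on the right, so it suffices to
   treat one algorithm with arbitrary functionals at a time. *)
rewrite -lee_pdivrMl// [X in (_ <= X)%E]e_avgE//.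
apply: le_ereal_inf_tmp => _ [L [phi [clfL [aphi ->]]]].
rewrite lee_pdivrMl//.
set I := (\int[mu]_f \int[lam]_(x in D) ((ev f x - phi (info L f) x) ^+ 2 * rho x)%:E)%E.
have I0 : (0 <= I)%E.
  apply: integral_ge0 => f _; apply: integral_ge0 => x Dx.
  case: setting => _ [_ [[_ [rho0 _]] _]].
  by rewrite lee_fin mulr_ge0 ?sqr_ge0// rho0.
apply: (@le_trans _ _ (sqrte ((1 + 4 * m%:R / n%:R)%:E * I)%E)); last first.
  rewrite /err_avg -/I sqrteM; last by rewrite lee_fin ltW.
  apply: lee_wpmul2r; first exact: sqrte_ge0.
  by rewrite lee_fin.
apply: sqrte_le_addgt0; first by rewrite mule_ge0// lee_fin ltW.
move=> t t0; rewrite e_avgE//.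
have [L' [phi' [stdL' aphi' err]]] :=
  std_sampling_error setting n0 mn t0 clfL aphi.
apply: (@le_trans _ _ (err_avg mu lam D rho ev L' phi')).
  by apply: ereal_inf_lbound; exists L', phi'.
rewrite lee_sqrt//; apply: adde_ge0; last by rewrite lee_fin ltW.
by rewrite mule_ge0// lee_fin ltW.
Qed.
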